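(* Let $d \geq 2$ be an integer and let $0 < c < \frac{1}{2^{2d + 1}d}$ be a constant. Then with high probability $X \sim X(n, c/\sqrt[d]{n})$ is almost $d$-collapsible.
   Context: $G(n,p)$ is the Erdős–Rényi random graph on $[n]$ with each edge included independently with probability $p$; $X \sim X(n,p)$ is the clique complex of $G\sim G(n,p)$, i.e. the simplicial complex whose faces are the cliques of $G$. ''With high probability'' means with probability tending to $1$ as $n\to\infty$. A face of a simplicial complex is free if it is properly contained in exactly one other face; removing a free face and its unique proper coface is an elementary collapse. The pure $d$-dimensional part of a complex $Y$ is the subcomplex whose facets are the $d$-dimensional faces of $Y$. $\diamondsuit_d$ denotes the boundary of the $(d+1)$-dimensional cross-polytope, i.e. the clique complex of the complete $(d+1)$-partite graph with two vertices in each part. A simplicial complex $X$ is almost $d$-collapsible if there is a sequence of elementary collapses from $X$ to a complex $Y$ of dimension at most $d$ whose pure $d$-dimensional part is a (possibly empty) face-disjoint union of copies of $\diamondsuit_d$. Here face-disjoint means that any two distinct copies share no face of dimension $d$ or $d-1$ (they may share faces of dimension at most $d-2$). *)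

(* Defs.v *)
From mathcomp Require Import all_boot all_order all_algebra.
From mathcomp Require Import all_classical all_reals all_analysis.

Set Implicit Arguments.
Unset Strict Implicit.
Unset Printing Implicit Defensive.

Import Order.TTheory GRing.Theory Num.Theory.
Import numFieldNormedType.Exports.

(* Simplicial complexes are finite families of nonempty sets, the empty face
   being left out. *)
Section Complexes.
Variable T : finType.
Implicit Types (e : rel T) (s t : {set T}) (X Y C : {set {set T}}).

Definition is_complex X : bool :=
  [forall s in X, (s != finset.set0) &&
    [forall t : {set T}, (t != finset.set0) && (t \subset s) ==> (t \in X)]].

Definition is_clique e s : bool :=
  [forall u in s, forall v in s, (u != v) ==> e u v].

Definition clique_complex e : {set {set T}} :=
  [set s : {set T} | (s != finset.set0) && is_clique e s].

(* Only meaningful for nonempty sets. *)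
Definition face_dim s : nat := #|s|.-1.

Definition proper_cofaces X s : {set {set T}} := [set t in X | s \proper t].

Definition is_free X s : bool := (s \in X) && (#|proper_cofaces X s| == 1).

Definition elementary_collapse : rel {set {set T}} := fun X Y =>
  [exists s, is_free X s && (Y == X :\: (s |: proper_cofaces X s))].

Definition collapses_to : rel {set {set T}} := connect elementary_collapse.

Definition dim_at_most (d : nat) Y : bool := [forall s in Y, face_dim s <= d].

Definition pure_part (d : nat) Y : {set {set T}} :=
  [set s in Y | [exists t in Y, (face_dim t == d) && (s \subset t)]].

End Complexes.

(* The parts of the complete (d+1)-partite graph are the pairs
   {(i, false), (i, true)}. *)
Definition diamond (d : nat) : {set {set 'I_d.+1 * bool}} :=
  clique_complex (fun u v : 'I_d.+1 * bool => u.1 != v.1).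

Definition is_diamond_copy (T : finType) (d : nat) (C : {set {set T}}) : bool :=
  [exists f : {ffun 'I_d.+1 * bool -> T},
    injectiveb f && (C == [set f @: s | s : {set 'I_d.+1 * bool} in diamond d])].

Definition face_disjoint (T : finType) (d : nat) (C1 C2 : {set {set T}}) : bool :=
  [forall s in C1 :&: C2, (face_dim s != d) && (face_dim s != d.-1)].

Definition face_disjoint_union_of_diamonds (T : finType) (d : nat)
    (Z : {set {set T}}) : bool :=
  [exists D : {set {set {set T}}},
    [&& [forall C in D, is_diamond_copy d C],
        [forall C1 in D, forall C2 in D,
          (C1 != C2) ==> face_disjoint d C1 C2]
      & Z == \bigcup_(C in D) C]].

Definition almost_collapsible (T : finType) (d : nat) (X : {set {set T}}) : bool :=
  [exists Y : {set {set T}},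
    [&& collapses_to X Y, dim_at_most d Y
      & face_disjoint_union_of_diamonds d (pure_part d Y)]].

Lemma clique_complex_is_complex (T : finType) (e : rel T) :
  is_complex (clique_complex e).
Proof.
apply/forall_inP => s; rewrite inE => /andP[s0 /forall_inP cs].
rewrite s0; apply/forallP => t; apply/implyP => /andP[t0 /fintype.subsetP ts].
rewrite inE t0; apply/forall_inP => u /ts us; apply/forall_inP => v /ts vs.
by have /forall_inP/(_ v vs) := cs u us.
Qed.

Lemma collapse_is_complex (T : finType) (X Y : {set {set T}}) :
  is_complex X -> elementary_collapse X Y -> is_complex Y.
Proof.
move=> /forall_inP cX /existsP[s /andP[/andP[sX /cards1P[t0 Et]] /eqP->]].
rewrite Et; apply/forall_inP => a; rewrite !inE negb_or -andbA => /and3P[as_ at_ aX].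
have /andP[-> /forallP cl] := cX a aX.
apply/forallP => b; apply/implyP => hb; have bX := implyP (cl b) hb.
case/andP: hb => _ ba; rewrite !inE bX andbT negb_or.
have sub c : c \in X -> s \proper c -> c = t0.
  by move=> cX' sc; apply/set1P; rewrite -Et inE cX'.
have st : s \proper t0.
  by have := set11 t0; rewrite -Et inE => /andP[].
have nsa : ~~ (s \proper a).
  by apply/negP => /(sub a aX) E; rewrite E eqxx in at_.
apply/andP; split; apply: contra nsa => /eqP E; rewrite E in ba.
  by rewrite finset.properEneq eq_sym as_.
exact: proper_sub_trans st ba.
Qed.

Local Open Scope ring_scope.

(* A simple graph on [n] is given by its edge set, a subset of [vpairs n]. *)
Definition vpairs (n : nat) : {set {set 'I_n}} := [set e : {set 'I_n} | #|e| == 2].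

Definition adj (n : nat) (E : {set {set 'I_n}}) : rel 'I_n :=
  fun u v => [set u; v] \in E.

Definition gnp_weight (R : realType) (n : nat) (p : R) (E : {set {set 'I_n}}) : R :=
  \prod_(e in vpairs n) (if e \in E then p else 1 - p).

Definition gnp_prob (R : realType) (n : nat) (p : R)
    (A : pred {set {set 'I_n}}) : R :=
  \sum_(E in powerset (vpairs n) | A E) gnp_weight p E.

Definition whp (R : realType) (p : nat -> R)
    (A : forall n, pred {set {set 'I_n}}) : Prop :=
  ((fun n => gnp_prob (p n) (@A n)) @ \oo --> (1 : R))%classic.

Lemma gnp_prob_total (R : realType) (n : nat) (p : R) :
  gnp_prob p (fun _ : {set {set 'I_n}} => true) = 1.
Proof.
rewrite /gnp_prob /gnp_weight.
pose P := vpairs n.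
transitivity (\prod_e ((if e \in P then p else 0) +
                       (if e \in P then 1 - p else 1))); last first.
  by apply: big1 => e _; case: ifP => _; rewrite ?add0r // addrC subrK.
rewrite bigA_distr [RHS](bigID (fun E => E \in powerset P)) /=.
rewrite [X in _ = _ + X]big1 ?addr0 => [|E].
  apply: eq_big => [E|E]; rewrite ?andbT //= powersetE => /fintype.subsetP EP.
  rewrite [RHS](bigID (fun e => e \in P)) /= [X in _ = _ * X]big1 ?mulr1.
    by apply: eq_bigr => e eP; rewrite eP.
  by move=> e eP; rewrite (negbTE eP); case: ifP => // /EP; rewrite (negbTE eP).
rewrite powersetE => /subsetPn[e eE eP].
by rewrite (bigD1 e) //= eE (negbTE eP) mul0r.
Qed.

(* Main.v *)
Require Import Defs.
From mathcomp Require Import all_boot all_order all_algebra.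
From mathcomp Require Import zify ring.

(* Call two cliques with more than d vertices adjacent when they share at least
   d vertices; collapses through free faces with at least d vertices do not
   interact between distinct components of this relation.

   Collapsing.  A clique complex on at most 2k+1 vertices collapses to faces
   with at most k vertices, and on 2k+2 vertices the only exception is the
   cross-polytope; both follow by induction on the links.  Hence, if a vertex v
   of a component has fewer than 2d neighbours among the vertices V of the
   component, or exactly 2d that do not span a cross-polytope, a collapse of
   the link of v removes every large face of the component through v.  If all
   dense enough subgraphs are excluded, i.e. V spans at most d|V| edges, and no
   such v exists, then every link is a cross-polytope, and so is V.

   Counting.  Listing V so that each vertex is adjacent to a d-clique of earlier
   ones, take the first prefix, with m vertices, spanning more than dm edges.
   The d-clique attached to a new vertex consists of its last vertex w and of
   earlier neighbours of w, so that up to d^2+1 exceptional edges a subgraph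
   with exactly dm+1 edges is encoded by a parent function and boundedly many
   bits per vertex.  There are (m 2^D)^m such codes, up to a polynomial factor,
   on each of the C(n, m) vertex sets, so the first moment is at most
   const * p * sum_m (2^(D+3) c^d)^m, which tends to 0 with p. *)

Set Implicit Arguments.
Unset Strict Implicit.
Unset Printing Implicit Defensive.

(** * Reductions of families of cliques *)

Ltac nat_lia :=
  repeat match goal with
  | H : ?P |- _ =>
    lazymatch P with
    | is_true (leq _ _) => fail
    | is_true (~~ (leq _ _)) => fail
    | @eq ?A _ _ => tryif unify A nat then fail else clear H
    | is_true (~~ (@eq_op _ _ _)) => fail
    | _ => clear H
    end
  end; lia.

(** Elementary collapses for arbitrary families, possibly containing the empty set. Only faces with
    at least [k] elements are removed; this bound is what lets a reduction be replayed inside a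
    larger family that has further small faces. *)
Inductive reduces (T : finType) (k : nat) :
    {set {set T}} -> {set {set T}} -> Prop :=
| reduces_refl (F : {set {set T}}) : reduces k F F
| reduces_step (F F' : {set {set T}}) (s t : {set T}) :
    s \in F -> t \in F -> s \proper t -> k <= #|s| ->
    (forall a, a \in F -> s \proper a -> a = t) ->
    reduces k (F :\ s :\ t) F' -> reduces k F F'.

Lemma reduces_trans (T : finType) k (F1 F2 F3 : {set {set T}}) :
  reduces k F1 F2 -> reduces k F2 F3 -> reduces k F1 F3.
Proof.
elim=> // F s t F' sF tF st ks uniq_t _ IH /IH; exact: reduces_step.
Qed.

(* [G] selects the pairs of the reduction that are carried over to [X]. *)
Lemma reduces_lift (T T' : finType) (phi : {set T} -> {set T'})
    (G : pred {set T}) k k' (F0 F1 : {set {set T}}) (X : {set {set T'}}) :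
  reduces k F0 F1 ->
  {in F0 &, injective phi} ->
  {in F0 &, forall a b : {set T}, a \proper b -> phi a \proper phi b} ->
  {in F0, forall a : {set T}, G a -> phi a \in X} ->
  {in F0, forall a : {set T}, k <= #|a| -> k' <= #|phi a|} ->
  {in F0 & X, forall (a : {set T}) (x : {set T'}), G a -> k <= #|a| -> phi a \proper x ->
     exists b, [/\ b \in F0, G b, x = phi b & a \proper b]} ->
  {in F0 &, forall a b : {set T}, k <= #|a| -> a \proper b -> G a = G b} ->
  reduces k' X (X :\: phi @: [set a in F0 :\: F1 | G a]).
Proof.
move=> red; elim: red X => {F0 F1} [F|F F' s t sF tF st ks ut red IH] X
  inj mono GX card cof GG.
  rewrite (_ : [set a in F :\: F | G a] = set0) ?imset0 ?setD0.
    exact: reduces_refl.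
  by apply/setP => a; rewrite !inE andNb.
have FF : {subset F :\ s :\ t <= F} by move=> a /setD1P[_ /setD1P[]].
have neq_st : s != t by apply: contraTneq st => ->; rewrite properxx.
have F'F : {subset F' <= F :\ s :\ t}.
  move: {IH} red; elim=> [? ? //|H H' s' t' _ _ _ _ _ _ sub a /sub].
  by rewrite !inE => /and3P[].
have Gst : G s = G t by exact: GG.
(* A pair rejected by [G] leaves the source family but corresponds to no move in [X]. *)
case Gs: (G s); last first.
  have -> : [set a in F :\: F' | G a] = [set a in (F :\ s :\ t) :\: F' | G a].
    apply/setP => a; rewrite !inE.
    case: (eqVneq a t) => [->|]; first by rewrite -Gst Gs !andbF.
    by case: (eqVneq a s) => [->|]; first by rewrite Gs !andbF.
  apply: IH.
  - by move=> a b /FF aF /FF bF; exact: inj.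
  - by move=> a b /FF aF /FF bF; exact: mono.
  - by move=> a /FF; exact: GX.
  - by move=> a /FF; exact: card.
  - move=> a x /FF aF xX Ga ka ax; have [b [bF Gb xb ab]] := cof a x aF xX Ga ka ax.
    exists b; split=> //; rewrite !inE bF andbT; apply/andP; split.
      by apply: contraTneq Gb => ->; rewrite -Gst Gs.
    by apply: contraTneq Gb => ->; rewrite Gs.
  - by move=> a b /FF aF /FF bF; exact: GG.
have Gt : G t by rewrite -Gst.
apply: (@reduces_step _ _ _ _ (phi s) (phi t)).
- exact: GX.
- exact: GX.
- exact: mono.
- exact: card.
- move=> x xX sx; have [b [bF Gb -> sb]] := cof s x sF xX Gs ks sx.
  by rewrite (ut b).
set X' := X :\ _ :\ _.
have -> : X :\: phi @: [set a in F :\: F' | G a] =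
          X' :\: phi @: [set a in (F :\ s :\ t) :\: F' | G a].
  apply/setP => x; rewrite !in_setD !in_set1.
  case: (boolP (x \in X)) => xX; rewrite ?andbF // !andbT.
  apply/idP/and3P => [nx|[nx xt xs]].
    split.
    - apply: contra nx => /imsetP[a]; rewrite inE => /andP[/setDP[/FF aF aF'] Ga] ->.
      by apply: imset_f; rewrite inE Ga inE aF' aF.
    - apply: contraNneq nx => ->; apply: imset_f; rewrite !inE Gt tF !andbT.
      by apply/negP => /F'F; rewrite !inE eqxx.
    - apply: contraNneq nx => ->; apply: imset_f; rewrite !inE Gs sF !andbT.
      by apply/negP => /F'F; rewrite !inE eqxx andbF.
  apply: contra nx => /imsetP[a]; rewrite inE => /andP[/setDP[aF aF'] Ga] E.
  rewrite E; apply: imset_f; rewrite !inE Ga aF aF' !andbT /=.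
  by apply/andP; split; [apply: contraNneq xt|apply: contraNneq xs] => <-; rewrite E.
apply: IH.
- by move=> a b /FF aF /FF bF; exact: inj.
- by move=> a b /FF aF /FF bF; exact: mono.
- move=> a aF Ga; have aF0 := FF a aF; move: aF; rewrite !inE => /and3P[nt ns _].
  by rewrite !(inj_in_eq inj) // nt ns GX.
- by move=> a /FF; exact: card.
- move=> a x /FF aF; rewrite !inE => /and3P[xt xs xX] Ga ka ax.
  have [b [bF Gb xb ab]] := cof a x aF xX Ga ka ax.
  exists b; split=> //; rewrite !inE bF andbT.
  by apply/andP; split; [apply: contraNneq xt|apply: contraNneq xs] => <-; rewrite xb.
- by move=> a b /FF aF /FF bF; exact: GG.
Qed.

Lemma elementary_collapse_pair (T : finType) (F : {set {set T}}) (s t : {set T}) :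
  s \in F -> t \in F -> s \proper t ->
  (forall a, a \in F -> s \proper a -> a = t) ->
  elementary_collapse F (F :\ s :\ t).
Proof.
move=> sF tF st ut.
have cof : proper_cofaces F s = [set t].
  apply/setP => a; rewrite !inE; apply/andP/eqP => [[aF sa]|->]; last by [].
  exact: ut.
apply/existsP; exists s.
by rewrite /is_free sF cof cards1 eqxx setDDl setUC eqxx.
Qed.

Lemma reduces_collapses (T : finType) k (X Y : {set {set T}}) :
  reduces k X Y -> collapses_to X Y.
Proof.
elim=> {X Y} [F|F F' s t sF tF st _ ut _ IH]; first exact: connect0.
exact/(connect_trans _ IH)/connect1/elementary_collapse_pair.
Qed.

(** The faces avoiding the apex [x] are matched with [x |: a], the largest ones first. Closure under
    adding and removing [x] is needed only in the sizes affected, and it survives the removal of a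
    matched pair. *)
Lemma reduces_cone (T : finType) (x : T) k (F : {set {set T}}) :
  {in F, forall a : {set T}, x \notin a -> k <= #|a| -> x |: a \in F} ->
  {in F, forall a : {set T}, x \in a -> k < #|a| -> a :\ x \in F} ->
  exists2 F', reduces k F F' & {in F', forall a : {set T}, #|a| <= k}.
Proof.
have [n] := ubnP #|F|; elim: n F => // n IH F ltFn up down.
pose P a := [&& a \in F, x \notin a & k <= #|a|].
case: (pickP P) => [a0 Pa0|noP]; last first.
  exists F; first exact: reduces_refl.
  move=> a aF; rewrite leqNgt; apply/negP => ka.
  have [xa|xa] := boolP (x \in a); last first.
    by have := noP a; rewrite /P aF xa ltnW.
  have := noP (a :\ x); rewrite /P down // !inE eqxx /=.
  by have := cardsD1 x a; rewrite xa; nat_lia.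
case: (arg_maxnP (fun a : {set T} => #|a|) Pa0) => a /and3P[aF xa ka] amax.
have ax : a \proper x |: a.
  by rewrite properEneq subsetUr andbT; apply: contraNneq xa => ->; rewrite setU11.
have xaF := up a aF xa ka.
(* By maximality of [a], a larger [b] contains [x]; then [b :\ x] is itself a candidate containing
   [a], so it has the same size and equals [a]. *)
have ua b : b \in F -> a \proper b -> b = x |: a.
  move=> bF ab; have ltab := proper_card ab.
  have xb : x \in b.
    apply/negPn/negP => xb.
    by have := amax b; rewrite /P bF xb; nat_lia.
  have := amax (b :\ x); rewrite /P down // ?inE ?eqxx //=; last nat_lia.
  have cb := cardsD1 x b; rewrite xb in cb => H.
  have : a == b :\ x.
    rewrite eqEcard; apply/andP; split; last by apply: H; nat_lia.
    by rewrite subsetD1 xa proper_sub.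
  by move=> /eqP ->; rewrite setD1K.
have FF : {subset F :\ a :\ (x |: a) <= F} by move=> b /setD1P[_ /setD1P[]].
have [|b bF xb kb|b bF xb kb|F' red F'k] := IH (F :\ a :\ (x |: a)).
- rewrite -ltnS; apply: leq_trans ltFn; rewrite ltnS.
  apply: proper_card; apply/properP; split; first exact/subsetP.
  by exists a => //; rewrite !inE eqxx andbF.
- rewrite !inE up ?FF // andbT; apply/andP; split.
    apply: contraTneq bF => E.
    have -> : b = a by rewrite -(setU1K xb) E setU1K.
    by rewrite !inE eqxx andbF.
  by apply: contraNneq xa => <-; rewrite setU11.
- rewrite !inE down ?FF // andbT; apply/andP; split.
    apply: contraTneq (setU11 x a) => <-; by rewrite !inE eqxx.
  apply: contraTneq bF => <-.
  by rewrite setD1K // !inE eqxx.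
exists F' => //; apply: reduces_step red => //.
Qed.

(** * Clique complexes on few vertices *)

Section CliqueFamilies.
Variables (T : finType) (e : rel T).
Hypothesis e_sym : symmetric e.
Implicit Types (a b N : {set T}) (v x : T).

(** The empty clique is included, so that adding [v] to the members of [cl (nbhd N v)] gives all
    cliques of [N] through [v], also the vertex itself. *)
Definition cl N := [set a : {set T} | (a \subset N) && is_clique e a].

Definition nbhd N v := [set u in N | (u != v) && e v u].

Definition good k N :=
  exists2 F, reduces k (cl N) F & {in F, forall a : {set T}, #|a| <= k}.

Lemma cliqueP a :
  reflect {in a &, forall u v, u != v -> e u v} (is_clique e a).
Proof.
apply: (iffP forall_inP) => [H u v ua va|H u ua].
  by move/forall_inP: (H u ua) => /(_ v va)/implyP.
by apply/forall_inP => v va; apply/implyP; exact: H.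
Qed.

Lemma clique_sub a b : a \subset b -> is_clique e b -> is_clique e a.
Proof.
move=> /subsetP ab /cliqueP cb; apply/cliqueP => u v /ab ub /ab vb; exact: cb.
Qed.

Lemma cliqueU1 v a : v \notin a ->
  is_clique e (v |: a) = is_clique e a && (a \subset nbhd a v).
Proof.
move=> va; apply/idP/andP => [cva|[ca /subsetP av]].
  split; first exact: clique_sub (subsetUr _ _) cva.
  apply/subsetP => u ua; rewrite inE ua /=.
  have uv : u != v by apply: contraNneq va => <-.
  rewrite uv; move/cliqueP: cva; apply; rewrite ?setU11 ?inE ?ua ?orbT //.
  by rewrite eq_sym.
apply/cliqueP => u w /setU1P[->|ua] /setU1P[->|wa]; rewrite ?eqxx //.
- by move: (av w wa); rewrite inE => /and3P[].
- by move: (av u ua); rewrite inE e_sym => /and3P[].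
- by move/cliqueP: ca; apply.
Qed.

Lemma nbhd_sub N v : nbhd N v \subset N.
Proof. by apply/subsetP => u; rewrite inE => /andP[]. Qed.

Lemma nbhd_notin N v : v \notin nbhd N v.
Proof. by rewrite inE eqxx andbF. Qed.

Lemma nbhd_clique N v a : a \subset nbhd N v -> v \in N ->
  (v |: a \in cl N) = (a \in cl N).
Proof.
move=> aN vN; have va : v \notin a by apply: contraNN (nbhd_notin N v); apply/subsetP.
rewrite !inE cliqueU1 // subUset sub1set vN /=.
rewrite (_ : a \subset nbhd a v) ?andbT //; apply/subsetP => u ua.
by have := subsetP aN u ua; rewrite !inE ua => /andP[].
Qed.

Lemma good_cone k N v : v \in N -> nbhd N v = N :\ v -> good k N.
Proof.
move=> vN nv; apply: (@reduces_cone _ v) => a.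
  move=> aN va _; rewrite nbhd_clique // nv subsetD1 va andbT.
  by move: aN; rewrite inE => /andP[].
rewrite !inE => /andP[aN ca] _ _.
by rewrite (subset_trans (subD1set _ _) aN) (clique_sub (subD1set _ _) ca).
Qed.

Lemma good_small k N : #|N| <= k -> good k N.
Proof.
move=> Nk; exists (cl N); first exact: reduces_refl.
by move=> a; rewrite inE => /andP[/subset_leq_card aN _]; exact: leq_trans Nk.
Qed.

(** Every superset of [v |: a] contains [v], so the reduction of the link lifts, with sizes raised
    by one, to the cliques through [v]. The survivors through [v] have at most [k.+1] elements and
    do not obstruct the reduction of [N :\ v] that follows. *)
Lemma good_remove k N v : v \in N -> good k (nbhd N v) -> good k.+1 (N :\ v) ->
  good k.+1 N.
Proof.
move=> vN [F1 red1 F1k] [F2 red2 F2k].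
have notin a : a \in cl (nbhd N v) -> v \notin a.
  rewrite inE => /andP[aN _]; apply: contraNN (nbhd_notin N v); exact/subsetP.
have mem a : a \in cl (nbhd N v) -> v |: a \in cl N.
  rewrite inE => /andP[aN ca]; rewrite nbhd_clique // inE ca andbT.
  exact: subset_trans aN (nbhd_sub N v).
have memV (x : {set T}) : v \in x -> x \in cl N -> x :\ v \in cl (nbhd N v).
  rewrite !inE => vx /andP[xN cx].
  rewrite (clique_sub (subD1set _ _) cx) andbT; apply/subsetP => u.
  rewrite !inE => /andP[uv ux]; rewrite uv (subsetP xN) //=.
  by move/cliqueP: cx; apply=> //; rewrite eq_sym.
pose R := (fun a => v |: a) @: [set a in cl (nbhd N v) :\: F1 | predT a].
have red : reduces k.+1 (cl N) (cl N :\: R).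
  apply: reduces_lift red1 _ _ _ _ _ _ => //.
  - by move=> a b /notin va /notin vb E; rewrite -(setU1K va) E setU1K.
  - move=> a b /notin va /notin vb ab; case/properP: ab => ab [u ub ua].
    apply/properP; split; first exact: setUS.
    exists u; rewrite !inE ?ub ?orbT // (negPf ua) orbF.
    by apply: contraNneq vb => <-.
  - by move=> a /mem.
  - by move=> a /notin va; rewrite cardsU1 va.
  - move=> a x aN xN _ ka; have va := notin a aN; rewrite properE subUset sub1set.
    move=> /andP[/andP[vx ax] nxa]; exists (x :\ v); split=> //.
    + exact: memV.
    + by rewrite setD1K.
    + rewrite properE subsetD1 ax va /=; apply: contra nxa => xa.
      by rewrite -(setD1K vx) setUS.
pose Y := [set v |: a | a in [set a in F1 | a \in cl (nbhd N v)]].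
have clvN a : a \in cl (N :\ v) -> v \notin a.
  by rewrite inE subsetD1 => /andP[/andP[]].
have E : cl N :\: R = cl (N :\ v) :|: Y.
  apply/setP => x; rewrite in_setD in_setU; apply/andP/orP => [[xR xN]|[]].
  - have [vx|vx] := boolP (v \in x); last first.
      by left; move: xN; rewrite !inE subsetD1 vx andbT.
    right; apply/imsetP; exists (x :\ v); rewrite ?setD1K // inE memV // andbT.
    apply: contraNT xR => nx; rewrite -(setD1K vx); apply: imset_f.
    by rewrite inE in_setD nx memV.
  - move=> xN; have vx := clvN x xN; split.
      by apply: contra vx => /imsetP[a _ ->]; rewrite setU11.
    by move: xN; rewrite !inE subsetD1 -andbA => /and3P[-> _ ->].
  - move=> /imsetP[a]; rewrite inE => /andP[aF1 aN] ->; split; last exact: mem.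
    apply/imsetP => -[b]; rewrite inE andbT in_setD => /andP[bF1 bN] E.
    by move: bF1; rewrite -(setU1K (notin b bN)) -E (setU1K (notin a aN)) aF1.
rewrite {}E in red.
have Yk y : y \in Y -> #|y| <= k.+1 /\ v \in y.
  move=> /imsetP[a]; rewrite inE => /andP[/F1k ka _] ->.
  by rewrite setU11 cardsU1; split=> //; case: (v \notin a) => /=; nat_lia.
pose R' := id @: [set a in cl (N :\ v) :\: F2 | predT a].
have redN : reduces k.+1 (cl N) ((cl (N :\ v) :|: Y) :\: R').
  apply: reduces_trans red _; apply: reduces_lift red2 _ _ _ _ _ _ => //.
  - by move=> a aN _; rewrite in_setU aN.
  (* A member of [Y] is too small to properly contain a face with [k.+1] elements. *)
  - move=> a x aN; rewrite in_setU => /orP[xN|xY] _ ka ax; first by exists x.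
    by have [? _] := Yk x xY; have := proper_card ax; nat_lia.
eexists; first exact: redN.
move=> a; rewrite in_setD in_setU => /andP[aR /orP[aN|/Yk[]//]].
have [/F2k//|aF2] := boolP (a \in F2).
by case/imsetP: aR; exists a; rewrite // inE andbT in_setD aF2.
Qed.

Lemma nbhd_proper_cone k N v : v \in N -> #|N|.-1 <= #|nbhd N v| -> good k N.
Proof.
move=> vN Nv; apply: good_cone (vN) _; apply/eqP; rewrite eqEcard.
have -> : nbhd N v \subset N :\ v by rewrite subsetD1 nbhd_sub nbhd_notin.
by move: Nv; rewrite (cardsD1 v N) vN.
Qed.

(** Either some vertex is adjacent to all others and is the apex of a cone, or the link of any
    vertex misses another vertex besides it. In the second case the link has two vertices fewer,
    which matches the drop of [k] by one. *)
Lemma good_odd k N : #|N| <= k.*2.+1 -> good k N.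
Proof.
elim: k N => [|k IHk] N.
  move=> N1; have [->|[v vN]] := set_0Vmem N; first by apply: good_small; rewrite cards0.
  by apply: (@nbhd_proper_cone _ _ v) => //; move: N1; case: #|N| => [|[]].
have [n] := ubnP #|N|; elim: n N => // n IHn N ltNn Nk.
have [->|[v vN]] := set_0Vmem N; first by apply: good_small; rewrite cards0.
have [Nv|Nv] := leqP #|N|.-1 #|nbhd N v|; first exact: nbhd_proper_cone Nv.
have cN := cardsD1 v N; rewrite vN /= in cN.
by apply: (good_remove vN); [apply: IHk|apply: IHn]; nat_lia.
Qed.

(** Each vertex has exactly one non-neighbour other than itself: the cocktail party graph, which is
    the 1-skeleton of a cross-polytope. *)
Definition cocktail N := forall v, v \in N -> #|nbhd N v|.+2 = #|N|.

(** A vertex with at least two non-neighbours has a link small enough for [good_odd], one level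
    lower, and deleting it leaves an odd bound for the rest. *)
Lemma good_even k N : #|N| <= k.+1.*2 -> good k N \/ #|N| = k.+1.*2 /\ cocktail N.
Proof.
move=> Nk; have [/good_odd|gtN] := leqP #|N| k.*2.+1; first by left.
have {gtN} cN : #|N| = k.+1.*2 by nat_lia.
have [/forall_inP H|] := boolP [forall v in N, #|nbhd N v|.+2 == #|N|].
  by right; split=> // v /H/eqP.
rewrite negb_forall_in => /exists_inP[v vN nv]; left.
have [Nv|Nv] := leqP #|N|.-1 #|nbhd N v|; first exact: nbhd_proper_cone Nv.
case: k cN Nk => [|k] cN Nk.
  by move: nv Nv; rewrite cN /=; case: #|_|.
have dN := cardsD1 v N; rewrite vN /= in dN.
by apply: (good_remove vN); apply: good_odd; nat_lia.
Qed.

End CliqueFamilies.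

(** * Strongly connected components *)

Section Components.
Variables (T : finType) (e : rel T) (d : nat).
Hypothesis e_sym : symmetric e.
Implicit Types (s t z : {set T}) (X : {set {set T}}) (v : T).

Definition big_faces X := [set s in X | d < #|s|].

Definition ridge_adj X : rel {set T} :=
  [rel s t | [&& s \in big_faces X, t \in big_faces X & d <= #|s :&: t|]].

Definition component X z := [set t | connect (ridge_adj X) z t].

Definition vsupport X z := \bigcup_(t in component X z) t.

Lemma ridge_adj_sym X : symmetric (ridge_adj X).
Proof. by move=> s t; rewrite /ridge_adj /= setIC andbCA. Qed.

Lemma component_refl X z : z \in component X z.
Proof. by rewrite inE connect0. Qed.

Lemma component_big X z t :
  z \in big_faces X -> t \in component X z -> t \in big_faces X.
Proof.
move=> zX; rewrite [t \in _]inE => zt; rewrite -(closed_connect _ zt) // => s1 s2.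
by case/and3P => -> ->.
Qed.

Lemma component_eq X z t : t \in component X z -> component X t = component X z.
Proof.
rewrite inE => zt; apply/setP => s; rewrite !inE; apply/esym.
exact: (same_connect (sym_connect_sym (@ridge_adj_sym X))).
Qed.

Lemma component_step X z t t' : z \in big_faces X -> t \in component X z ->
  t' \in X -> d < #|t'| -> d <= #|t :&: t'| -> t' \in component X z.
Proof.
move=> zX tz t'X dt' tt'; have tX := component_big zX tz.
rewrite inE; rewrite inE in tz; apply: connect_trans tz (connect1 _).
by apply/and3P; split; rewrite // inE t'X.
Qed.

Lemma component_ind X z (P : {set T} -> Prop) :
  P z -> (forall s t, s \in component X z -> t \in component X z ->
           d <= #|s :&: t| -> P s -> P t) ->
  forall t, t \in component X z -> P t.
Proof.
move=> Pz step t; rewrite inE => /connectP[p].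
elim/last_ind: p t => [|p x IH] t /=; first by move=> _ ->.
rewrite rcons_path last_rcons => /andP[zp px] ->.
have zl : last z p \in component X z by rewrite inE; apply/connectP; exists p.
have zx : x \in component X z.
  by move: zl; rewrite !inE => zl; apply: connect_trans zl (connect1 px).
by apply: (step _ _ zl zx); [case/and3P: px | exact: IH].
Qed.

Lemma sub_vsupport X z t : t \in component X z -> t \subset vsupport X z.
Proof. by move=> tz; apply: (bigcup_max t). Qed.

Lemma vsupport_eq X z t : t \in component X z -> vsupport X t = vsupport X z.
Proof. by move=> tz; rewrite /vsupport (component_eq tz). Qed.

(* Every component of a saturated complex is a full component of the clique
   complex of the graph induced on its vsupport. *)
Definition saturated X : Prop :=
  [/\ is_complex X, X \subset clique_complex e
    & forall z t, z \in big_faces X -> is_clique e t -> d < #|t| ->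
        t \subset vsupport X z -> d <= #|t :&: z| -> t \in X].

(** All members of a component have the same vertex support, so saturation may be applied at [z']
    instead of [z]. *)
Lemma saturated_component X z t z' : saturated X -> z \in big_faces X ->
  z' \in component X z -> is_clique e t -> d < #|t| ->
  t \subset vsupport X z -> d <= #|t :&: z'| -> t \in component X z.
Proof.
move=> [_ _ sat] zX z'z ct dt tz tz'.
apply: component_step (z'z) _ _ _ => //; last by rewrite setIC.
by apply: (sat z') => //; [exact: component_big z'z | rewrite (vsupport_eq z'z)].
Qed.

Lemma complex_sub X s t : is_complex X -> s \in X -> t \subset s -> t != set0 ->
  t \in X.
Proof.
by move=> /forall_inP cX /cX /andP[_ /forallP/(_ t)/implyP H] ts t0; rewrite H ?t0.
Qed.

Lemma reduces_complex k X Y : reduces k X Y -> is_complex X -> is_complex Y.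
Proof.
elim=> {X Y} // F F' s t sF tF st _ ut _ IH cF; apply: IH.
exact: collapse_is_complex cF (elementary_collapse_pair sF tF st ut).
Qed.

Lemma saturated_clique_complex : saturated (clique_complex e).
Proof.
split=> //; first exact: clique_complex_is_complex.
move=> z t _ ct dt _ _; rewrite inE ct andbT -card_gt0; exact: leq_ltn_trans dt.
Qed.

Lemma mem_clique X s : X \subset clique_complex e -> s \in X -> is_clique e s.
Proof. by move=> /subsetP sub /sub; rewrite inE => /andP[]. Qed.

(** The reduction of the full link of [v] in the graph on the support is lifted by [a] to [v |: a],
    but carried out only on faces of this component. Since the link reduces to sets of at most [k]
    vertices, no face through [v] with more than [d] vertices is left in the component. *)
Lemma sub_component_reduces k X z v : d = k.+1 -> saturated X ->
  z \in big_faces X -> v \in vsupport X z -> good e k (nbhd e (vsupport X z) v) ->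
  exists X', [/\ reduces d X X', saturated X' & X' \proper X].
Proof.
move=> dk satX zX vV [F1 red F1k].
have [cX clX sat] := satX; set V := vsupport X z in vV red *.
pose G (a : {set T}) := [exists z' in component X z, v |: a \subset z'].
set N := nbhd e V v in red.
have notin a : a \in cl e N -> v \notin a.
  rewrite inE => /andP[aN _]; apply: contraNN (nbhd_notin e V v); exact/subsetP.
have inN s : s \in component X z -> v \in s -> s :\ v \in cl e N.
  move=> sz vs; have sX := component_big zX sz; rewrite inE in sX.
  have cs := mem_clique clX (proj1 (andP sX)).
  rewrite inE (clique_sub (subD1set _ _) cs) andbT; apply/subsetP => u.
  rewrite !inE => /andP[uv us]; rewrite uv (subsetP (sub_vsupport sz)) //=.
  by move/cliqueP: cs; apply=> //; rewrite eq_sym.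
have cl_clique a : a \in cl e N -> is_clique e (v |: a) /\ v |: a \subset V.
  move=> aN; have : v |: a \in cl e V.
    rewrite nbhd_clique //; move: aN; rewrite !inE => /andP[aN ca] //.
    by rewrite ca (subset_trans aN (nbhd_sub _ _ _)).
  by rewrite inE => /andP[].
pose R := (fun a => v |: a) @: [set a in cl e N :\: F1 | G a].
have redX : reduces d X (X :\: R).
  apply: reduces_lift red _ _ _ _ _ _.
  - by move=> a b /notin va /notin vb E; rewrite -(setU1K va) E setU1K.
  - move=> a b /notin va /notin vb /properP[ab [u ub ua]].
    apply/properP; split; first exact: setUS.
    exists u; rewrite !inE ?ub ?orbT // (negPf ua) orbF.
    by apply: contraNneq vb => <-.
  - move=> a aN /exists_inP[z' z'z az'].
    apply: complex_sub cX _ az' _; last by apply/set0Pn; exists v; rewrite setU11.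
    by have := component_big zX z'z; rewrite inE => /andP[].
  - by move=> a /notin va; rewrite cardsU1 va dk.
  - move=> a x aN xX /exists_inP[z' z'z az'] ka ax; have va := notin a aN.
    have da : d <= #|v |: a| by rewrite cardsU1 va dk.
    have xz : x \in component X z.
      apply: component_step (z'z) _ _ _ => //.
        by have := proper_card ax; nat_lia.
      apply: leq_trans da _; apply: subset_leq_card.
      by rewrite subsetI az' proper_sub.
    have vx : v \in x by rewrite (subsetP (proper_sub ax)) // setU11.
    exists (x :\ v); split.
    + exact: inN.
    + by apply/exists_inP; exists x; rewrite // setD1K.
    + by rewrite setD1K.
    + case/properP: ax => ax [u ux uva]; apply/properP; split.
        by rewrite subsetD1 va andbT (subset_trans (subsetUr _ _) ax).
      by move: uva; rewrite !inE negb_or => /andP[uv ua]; exists u; rewrite // !inE uv.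
  (* Both members of a pair have the same status: if [v |: a], with at least [d] vertices, lies in a
     face [z'] of the component, then [v |: b] meets [z'] in [d] vertices and belongs to the
     component by saturation. *)
  - move=> a b aN bN ka ab; apply/exists_inP/exists_inP => [[z' z'z az']|[z' z'z bz']].
      have [cb bV] := cl_clique b bN; exists (v |: b); last by [].
      have := proper_card ab; have va := notin a aN; have vb := notin b bN => ltab.
      apply: saturated_component (z'z) _ _ _ _ => //.
        by rewrite cardsU1 vb; nat_lia.
      apply: leq_trans (_ : #|v |: a| <= _); first by rewrite cardsU1 va; nat_lia.
      by apply: subset_leq_card; rewrite subsetI az' setUS // proper_sub.
    exists z' => //; apply: subset_trans bz'; exact: setUS (proper_sub ab).
have bigX' x : x \in big_faces X ->
    (x \in X :\: R) = ~~ ((v \in x) && (x \in component X z)).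
  rewrite inE => /andP[xX dx]; rewrite in_setD xX andbT; congr (~~ _).
  apply/imsetP/andP => [[a]|[vx xz]].
    rewrite inE => /andP[_ /exists_inP[z' z'z az']] E; rewrite E setU11 -E.
    split=> //; apply: component_step (z'z) _ _ _ => //.
    by apply: leq_trans (ltnW dx) _; apply: subset_leq_card; rewrite subsetI E az' subxx.
  exists (x :\ v); last by rewrite setD1K.
  rewrite inE in_setD inN // andbT; apply/andP; split.
    apply: contraL dx => /F1k; have := cardsD1 v x; rewrite vx; nat_lia.
  by apply/exists_inP; exists x; rewrite // setD1K.
exists (X :\: R); split => //; last first.
  case/bigcupP: vV => x xz vx; have xX := component_big zX xz.
  apply/properP; split; first exact: subsetDl.
  exists x; first by move: xX; rewrite inE => /andP[].
  by rewrite bigX' // vx xz.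
split; first exact: reduces_complex redX cX.
  exact: subset_trans (subsetDl _ _) clX.
move=> z1 t z1X' ct dt tz1 dtz1.
have subX : {subset big_faces (X :\: R) <= big_faces X}.
  by move=> x; rewrite !inE -!andbA => /and3P[_ -> ->].
have subC : {subset component (X :\: R) z1 <= component X z1}.
  move=> x; rewrite !inE; apply: connect_sub => {}x y /and3P[/subX xX /subX yX xy].
  by apply: connect1; apply/and3P; split.
have z1X := subX _ z1X'.
have tV1 : t \subset vsupport X z1.
  apply: subset_trans tz1 _; apply/bigcupsP => x /subC; exact: sub_vsupport.
have tz : t \in component X z1.
  by apply: saturated_component (component_refl X z1) _ _ _ _.
rewrite bigX'; last exact: component_big tz.
(* If [t] had been removed, [v] would lie in the support of [z1] after the removal, hence in a
   surviving big face [x]. But [x] belongs to the component of [z] in [X], so it would have been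
   removed too. *)
apply/andP => -[vt tzz].
case/bigcupP: (subsetP tz1 v vt) => x xz1 vx.
have xX' := component_big z1X' xz1.
have := bigX' x (subX _ xX'); move: (xX'); rewrite inE => /andP[-> _].
rewrite vx /= -(component_eq tzz) (component_eq tz) => /esym/negP; apply.
exact: subC.
Qed.

End Components.

(** * Cross-polytopes *)

Section Cocktail.
Variables (T : finType) (e : rel T).
Hypothesis e_sym : symmetric e.
Implicit Types (s t z V : {set T}) (X : {set {set T}}) (u v x y : T).

(** The antipode of [v]; under [cocktail] the vertex picked exists and is unique. *)
Definition anti V v := odflt v [pick y in V | (y != v) && ~~ e v y].

Lemma antiP V v : cocktail e V -> v \in V ->
  [/\ anti V v \in V, anti V v != v
    & {in V, forall y, y != v -> e v y = (y != anti V v)}].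
Proof.
move=> cV vV; have cN := cV v vV.
have nV : [set y in V | (y != v) && ~~ e v y] = (V :\ v) :\: nbhd e V v.
  by apply/setP => y; rewrite !inE; do !case: (_ \in _); case: (y != v); case: e.
have cD := cardsD1 v V; rewrite vV /= in cD.
have : #|[set y in V | (y != v) && ~~ e v y]| == 1.
  rewrite nV cardsD (setIidPr _); first by apply/eqP; nat_lia.
  by rewrite subsetD1 nbhd_sub nbhd_notin.
case/cards1P => w /setP w1.
have wP y : (y \in V) && ((y != v) && ~~ e v y) = (y == w).
  by have := w1 y; rewrite !inE.
have -> : anti V v = w.
  rewrite /anti; case: pickP => [y|/(_ w)]; rewrite wP; first by move/eqP.
  by rewrite eqxx.
have := wP w; rewrite eqxx => /and3P[wV wv _]; split=> // y yV yv.
by have := wP y; rewrite yV yv /= => <-; rewrite negbK.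
Qed.

Lemma antiK V v : cocktail e V -> v \in V -> anti V (anti V v) = v.
Proof.
move=> cV vV; have [aV av eV] := antiP cV vV; have [_ _ eaV] := antiP cV aV.
have := eV _ aV av; rewrite eqxx e_sym eaV 1?eq_sym // => /negbT.
by rewrite negbK => /eqP.
Qed.

Lemma anti_eq V v y : cocktail e V -> v \in V -> y \in V -> y != v -> ~~ e v y ->
  y = anti V v.
Proof.
move=> cV vV yV yv; have [_ _ ->] := antiP cV vV => //; rewrite negbK.
by move/eqP.
Qed.

Lemma anti_inj V : cocktail e V -> {in V &, injective (anti V)}.
Proof. by move=> cV x y xV yV E; rewrite -(antiK cV xV) E antiK. Qed.

Lemma anti_notin V s v : cocktail e V -> s \subset V -> is_clique e s -> v \in s ->
  anti V v \notin s.
Proof.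
move=> cV /subsetP sV /cliqueP cs vs; have [_ av eV] := antiP cV (sV v vs).
apply/negP => avs; have := cs v (anti V v) vs avs; rewrite eq_sym => /(_ av).
by rewrite eV ?sV // eqxx.
Qed.

Lemma anti_disjoint V s : cocktail e V -> s \subset V -> is_clique e s ->
  #|s :|: anti V @: s| = #|s|.*2 /\ s :|: anti V @: s \subset V.
Proof.
move=> cV sV cs; split.
  rewrite cardsU (_ : s :&: _ = set0).
    rewrite cards0 subn0 card_in_imset ?addnn // => x y xs ys.
    by apply: anti_inj; rewrite ?(subsetP sV).
  apply/setP => x; rewrite !inE; apply/andP => -[xs /imsetP[y ys E]].
  by have := anti_notin cV sV cs ys; rewrite -E xs.
rewrite subUset sV; apply/subsetP => _ /imsetP[x xs ->].
by have [] := antiP cV (subsetP sV x xs).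
Qed.

Lemma cocktail_clique_card V d s : #|V| = d.+1.*2 -> cocktail e V ->
  s \subset V -> is_clique e s -> #|s| <= d.+1.
Proof.
move=> cardV cV sV cs; have [E /subset_leq_card] := anti_disjoint cV sV cs.
by rewrite E cardV; nat_lia.
Qed.

(** The facet [z] meets every antipodal pair once. From each pair, [t] keeps the vertex in [s] if
    there is one and the vertex in [z] otherwise. *)
Lemma cocktail_clique_ext V d z s : #|V| = d.+1.*2 -> cocktail e V ->
  z \subset V -> is_clique e z -> #|z| = d.+1 -> s \subset V -> is_clique e s ->
  exists t, [/\ s \subset t, t \subset V, is_clique e t & #|t| = d.+1].
Proof.
move=> cardV cV zV cz cardz sV cs.
pose t := s :|: [set y in z | anti V y \notin s].
have tV : t \subset V.
  rewrite subUset sV; apply/subsetP => y; rewrite inE => /andP[yz _].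
  exact: (subsetP zV).
have ct : is_clique e t.
  have sz x y : x \in s -> y \in z -> anti V y \notin s -> x != y -> e x y.
    move=> xs yz ays xy; have xV := subsetP sV x xs; have yV := subsetP zV y yz.
    have [_ _ ->] := antiP cV xV; rewrite // 1?[y == x]eq_sym //.
    by apply: contraNneq ays => ->; rewrite antiK.
  apply/cliqueP => x y; rewrite !inE => /orP[xs|/andP[xz xs]] /orP[ys|/andP[yz ys]].
  - by move/cliqueP: cs; apply.
  - exact: sz.
  - by rewrite eq_sym e_sym; exact: sz.
  - by move/cliqueP: cz; apply.
exists t; split=> //; first exact: subsetUl.
apply/eqP; rewrite eqn_leq (cocktail_clique_card cardV) //= -cardz.
(* [h] chooses an element of [t] in the antipodal pair of [y]; distinct vertices of the clique [z]
   lie in distinct pairs. *)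
pose h y := if anti V y \in s then anti V y else y.
have hinj : {in z &, injective h}.
  move=> x y xz yz; rewrite /h.
  have xV := subsetP zV x xz; have yV := subsetP zV y yz.
  case: ifP => _; case: ifP => _ E //; first exact: (anti_inj cV).
    by have := anti_notin cV zV cz xz; rewrite E yz.
  by have := anti_notin cV zV cz yz; rewrite -E xz.
rewrite -(card_in_imset hinj); apply: subset_leq_card.
apply/subsetP => _ /imsetP[y yz ->]; rewrite /h !inE.
by case: (boolP (anti V y \in s)) => [->|ys] //; rewrite yz ys orbT.
Qed.

Definition induced_complex V :=
  [set s : {set T} | (s != set0) && (s \subset V) && is_clique e s].

Lemma cocktail_diamond V d z : #|V| = d.+1.*2 -> cocktail e V ->
  z \subset V -> is_clique e z -> #|z| = d.+1 ->
  is_diamond_copy d (induced_complex V).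
Proof.
move=> cardV cV zV cz cardz.
have [v0 v0z] : exists v0, v0 \in z by apply/set0Pn; rewrite -card_gt0 cardz.
pose g (i : 'I_d.+1) := nth v0 (enum z) i.
have gz i : g i \in z by rewrite -mem_enum mem_nth // -cardE cardz.
have gV i : g i \in V by exact: (subsetP zV).
have ginj : injective g.
  move=> i j /eqP; rewrite nth_uniq ?enum_uniq -?cardE ?cardz // => /eqP; exact: val_inj.
(* Part [i] of the multipartite graph is sent to the [i]-th vertex of [z] and its antipode. *)
pose f := [ffun p : 'I_d.+1 * bool => if p.2 then anti V (g p.1) else g p.1].
have fV p : f p \in V by rewrite ffunE; case: ifP => _ //; have [] := antiP cV (gV p.1).
have finj : injective f.
  have na i j : anti V (g i) <> g j.
    by move=> E; have := anti_notin cV zV cz (gz i); rewrite E gz.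
  move=> [i b] [j c]; rewrite !ffunE /=; case: b; case: c => //.
  - by move/(anti_inj cV (gV i) (gV j))/ginj => ->.
  - by move/na.
  - by move/esym/na.
  - by move/ginj => ->.
have fanti p : anti V (f p) = f (p.1, ~~ p.2).
  by rewrite !ffunE /=; case: p.2 => //=; rewrite antiK.
have fe p q : p != q -> e (f p) (f q) = (p.1 != q.1).
  move=> pq; have [_ _ ->] := antiP cV (fV p);
    rewrite ?fV ?(inj_eq finj) 1?[q == p]eq_sym //.
  rewrite fanti (inj_eq finj); case: p q pq => [i b] [j c] /=.
  by rewrite !xpair_eqE [j == i]eq_sym; case: (i == j); case: b; case: c.
have fsurj v : v \in V -> exists p, v = f p.
  have : f @: setT = V.
    apply/eqP; rewrite eqEcard; apply/andP; split.
      by apply/subsetP => _ /imsetP[p _ ->].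
    by rewrite card_imset // cardsT card_prod card_ord card_bool cardV -mul2n mulnC.
  by move=> <- /imsetP[p _ ->]; exists p.
apply/existsP; exists f; apply/andP; split; first by apply/injectiveP.
apply/eqP/setP => s; rewrite inE; apply/idP/imsetP => [/andP[/andP[s0 sV] cs]|[s']].
  have sE : s = f @: (f @^-1: s).
    apply/setP => v; apply/idP/imsetP => [vs|[p]]; last by rewrite inE => ? ->.
    by have [p pE] := fsurj v (subsetP sV v vs); exists p; rewrite // inE -pE.
  exists (f @^-1: s); last by [].
  rewrite inE; apply/andP; split.
    by apply: contraNneq s0 => E; rewrite sE E imset0.
  apply/cliqueP => p q; rewrite !inE => ps qs pq; rewrite -fe //.
  by move/cliqueP: cs; apply; rewrite // (inj_eq finj).
rewrite inE => /andP[s'0 /cliqueP cs'] ->; rewrite -andbA; apply/and3P; split.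
- by have /set0Pn[p ps] := s'0; apply/set0Pn; exists (f p); exact: imset_f.
- by apply/subsetP => _ /imsetP[p _ ->].
- apply/cliqueP => _ _ /imsetP[p ps ->] /imsetP[q qs ->]; rewrite (inj_eq finj) => pq.
  by rewrite fe // cs'.
Qed.

End Cocktail.

(** * Almost collapsibility of locally sparse graphs *)

Section Deterministic.
Variables (T : finType) (e : rel T) (d : nat).
Hypothesis e_sym : symmetric e.
Implicit Types (s t z V : {set T}) (X : {set {set T}}) (u v x y : T).

Lemma nbhd_sym V u v : u \in V -> v \in V -> (u \in nbhd e V v) = (v \in nbhd e V u).
Proof. by move=> uV vV; rewrite !inE uV vV eq_sym e_sym. Qed.

(* For v0 in the support, the antipode w u of v0 in the link of u is the same
   vertex for all u in the link of v0; it is the pole opposite to v0. *)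
Lemma cocktail_links X z : 1 < d -> X \subset clique_complex e ->
  z \in big_faces d X ->
  {in vsupport d X z, forall v, #|nbhd e (vsupport d X z) v| = d.*2 /\
                             cocktail e (nbhd e (vsupport d X z) v)} ->
  #|vsupport d X z| = d.+1.*2 /\ cocktail e (vsupport d X z).
Proof.
move=> d1 clX zX link; set V := vsupport d X z in link *; set N := nbhd e V in link *.
have zV : z \subset V by exact/sub_vsupport/component_refl.
have [v0 v0z] : exists v0, v0 \in z.
  by apply/set0Pn; rewrite -card_gt0; move: zX; rewrite inE => /andP[_]; nat_lia.
have v0V := subsetP zV v0 v0z; have [cN0 ckN0] := link v0 v0V.
have N0V u : u \in N v0 -> u \in V by exact/subsetP/nbhd_sub.
have vN0 u : u \in N v0 -> v0 \in N u by move=> uN; rewrite nbhd_sym // N0V.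
pose w u := anti e (N u) v0.
have wP u : u \in N v0 -> [/\ w u \in N u, w u != v0 & w u \notin N v0].
  move=> uN; have [_ ck] := link u (N0V u uN); have [wN wv ev] := antiP ck (vN0 u uN).
  split=> //; rewrite inE negb_and; apply/orP; right.
  by rewrite /= ev // eqxx andbF.
have wV u : u \in N v0 -> w u \in V.
  by case/wP => wN _ _; move: wN; rewrite inE => /andP[].
have wuniq u y : u \in N v0 -> y \in N u -> y != v0 -> y \notin N v0 -> y = w u.
  move=> uN yN yv ny; have [_ ck] := link u (N0V u uN).
  apply: anti_eq (vN0 u uN) _ _ _ => //; apply: contra ny => ev.
  by rewrite inE yv ev /=; move: yN; rewrite inE => /andP[->].
(* In the link of [u] the only other vertex not adjacent to [w u] is [v0], so [w u] is adjacent to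
   [y], and [wuniq] at [y] identifies it with [w y]. *)
have wadj u y : u \in N v0 -> y \in N v0 -> y \in N u -> w u = w y.
  move=> uN yN yu; have [wN wv nw] := wP u uN; apply: wuniq => //.
  rewrite nbhd_sym ?wV ?N0V // inE N0V //=; apply/andP; split.
    by apply: contraNneq nw => <-.
  have [_ ck] := link u (N0V u uN); have [_ _ ->] := antiP ck wN => //.
    rewrite antiK ?vN0 //; by apply: contraTneq yN => ->; rewrite nbhd_notin.
  by apply: contraNneq nw => <-.
have [u0 u0N] : exists u0, u0 \in N v0 by apply/set0Pn; rewrite -card_gt0 cN0; nat_lia.
have sub_adj u y : u \in N v0 -> y \in N v0 -> y != u -> y != anti e (N v0) u -> y \in N u.
  move=> uN yN yu ya; rewrite inE N0V // yu /=.
  by have [_ _ ->] := antiP ckN0 uN.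
have w0 u : u \in N v0 -> w u = w u0.
  move=> uN; have [->//|uu0] := eqVneq u u0.
  have [ua|ua] := eqVneq u (anti e (N v0) u0); last exact/esym/wadj/sub_adj.
  have aN : anti e (N v0) u0 \in N v0 by rewrite -ua.
  (* The antipodal vertices [u0] and [u] are not adjacent, but as the link has [d.*2 > 2] vertices
     there is a third one, adjacent to both. *)
  have [y yP] : exists y, y \in N v0 :\: [set u0; u].
    apply/set0Pn; rewrite -card_gt0 cardsD subn_gt0 cN0.
    apply: leq_ltn_trans (subset_leq_card (subsetIr _ _)) _.
    by rewrite cards2; case: eqP => _ /=; nat_lia.
  move: yP; rewrite !inE negb_or -andbA => /and3P[yu0 yu yN]; rewrite -/(N v0) in yN *.
  have {}yN : y \in N v0 by rewrite inE.
  have a2 : anti e (N v0) u = u0 by rewrite ua antiK.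
  rewrite (wadj u0 y) //; last by apply: sub_adj; rewrite -?ua.
  by apply: wadj => //; apply: sub_adj; rewrite ?a2.
have [w0N w0v w0n] := wP u0 u0N; have w1V := wV u0 u0N.
move: (w u0) w0 w0N w0v w0n w1V => w1 w0 w0N w0v w0n w1V.
have N0w : N v0 = N w1.
  apply/eqP; rewrite eqEcard cN0 (link w1 w1V).1 leqnn andbT.
  apply/subsetP => u uN; rewrite nbhd_sym ?(N0V u) // -(w0 u uN).
  by have [] := wP u uN.
(* The suspension of the link of [v0] with poles [v0] and [w1]. It is closed under taking
   neighbours, so connectedness of the component makes it the whole support. *)
pose W := v0 |: (w1 |: N v0).
have closedW x : x \in W -> N x \subset W.
  move=> /setU1P[->|/setU1P[->|xN]].
  - by rewrite /W setUA subsetUr.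
  - by rewrite -N0w /W setUA subsetUr.
  apply/subsetP => y yx; rewrite !in_setU !in_set1.
  have [//|yv] := eqVneq y v0; have [yN|yN] := boolP (y \in N v0); first by rewrite orbT.
  by rewrite (wuniq x y) // w0 // eqxx.
have VW : V = W.
  apply/eqP; rewrite eqEsubset; apply/andP; split; last first.
    by rewrite !subUset !sub1set v0V w1V nbhd_sub.
  have cW t x : t \in component d X z -> x \in t -> x \in W -> t \subset W.
    move=> tz xt xW; apply/subsetP => y yt; have [->//|yx] := eqVneq y x.
    apply: (subsetP (closedW x xW)); rewrite inE (subsetP (sub_vsupport tz)) //= yx /=.
    have := component_big zX tz; rewrite inE => /andP[/(mem_clique clX)/cliqueP ct _].
    by apply: ct => //; rewrite eq_sym.
  apply/bigcupsP; apply: component_ind.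
    by apply: (cW z v0); rewrite ?component_refl // setU11.
  move=> s t sz tz dst sW.
  have /set0Pn[x] : s :&: t != set0 by rewrite -card_gt0; nat_lia.
  by rewrite inE => /andP[xs xt]; apply: (cW t x) => //; exact: (subsetP sW).
have cV : #|V| = d.+1.*2.
  rewrite VW /W !cardsU1 !in_setU1 negb_or (negPf w0n) eq_sym w0v nbhd_notin cN0.
  by nat_lia.
by split=> // v vV; rewrite (link v vV).1 cV.
Qed.

(** Facets of a cross-polytope are joined by exchanging one vertex for its antipode, which keeps [d]
    vertices in common. Exchanging a vertex of [t] outside [z] brings [t] closer to [z], and
    saturation carries membership back. *)
Lemma cocktail_component X z t : saturated e d X -> z \in big_faces d X ->
  #|vsupport d X z| = d.+1.*2 -> cocktail e (vsupport d X z) ->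
  t \subset vsupport d X z -> is_clique e t -> #|t| = d.+1 -> t \in component d X z.
Proof.
move=> satX zX; set V := vsupport d X z => cardV cV.
have [cX clX _] := satX.
have zV : z \subset V by exact/sub_vsupport/component_refl.
have cz : is_clique e z by move: zX; rewrite inE => /andP[/(mem_clique clX)].
have cardz : #|z| = d.+1.
  apply/eqP; rewrite eqn_leq (cocktail_clique_card e_sym cardV) //=.
  by move: zX; rewrite inE => /andP[].
have [n] := ubnP #|t :\: z|; elim: n t => // n IH t ltn tV ct cardt.
have [tz|/subsetPn[x xt xz]] := boolP (t \subset z).
  suff -> : t = z by exact: component_refl.
  by apply/eqP; rewrite eqEcard tz cardz cardt leqnn.
have xV := subsetP tV x xt; have [aV ax _] := antiP cV xV.
have az : anti e V x \in z.
  have [cU sU] := anti_disjoint e_sym cV zV cz.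
  have : x \in z :|: anti e V @: z.
    suff -> : z :|: anti e V @: z = V by [].
    by apply/eqP; rewrite eqEcard sU cU cardV cardz leqnn.
  rewrite inE (negPf xz) => /imsetP[y yz ->].
  by rewrite antiK // (subsetP zV).
have at_ : anti e V x \notin t by exact: anti_notin.
pose t' := anti e V x |: t :\ x.
have t't : t :\ x \subset t' by exact: subsetUr.
have at' : anti e V x \notin t :\ x by rewrite inE (negPf at_) andbF.
have dt : #|t :\ x| = d by have := cardsD1 x t; rewrite xt cardt; nat_lia.
have t'z : t' \in component d X z.
  apply: IH.
  - apply: leq_trans (_ : #|t :\: z| <= _); last by rewrite -ltnS.
    apply: proper_card; apply/properP; split.
      apply/subsetP => y; rewrite !inE => /andP[yz /orP[/eqP E|/andP[_ ->]]].
        by rewrite E az in yz.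
      by rewrite yz.
    by exists x; rewrite !inE ?xt ?xz // eqxx /= orbF [x == _]eq_sym (negPf ax).
  - by rewrite subUset sub1set aV (subset_trans (subD1set _ _) tV).
  - rewrite cliqueU1 // (clique_sub (subD1set _ _) ct) /=; apply/subsetP => y.
    rewrite !inE => /andP[yx yt]; rewrite yx yt /=.
    have ya : y != anti e V x by apply: contraNneq at_ => <-.
    rewrite ya /=; have [_ _ ->] := antiP cV aV; rewrite ?(subsetP tV) //.
    by rewrite antiK.
  - by rewrite cardsU1 at' dt.
apply: (saturated_component satX zX t'z ct); rewrite ?cardt //.
by rewrite -dt; apply: subset_leq_card; rewrite subsetI t't subD1set.
Qed.

Lemma cocktail_components_diamonds X : 1 < d -> saturated e d X ->
  {in big_faces d X, forall z,
    #|vsupport d X z| = d.+1.*2 /\ cocktail e (vsupport d X z)} ->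
  dim_at_most d X && face_disjoint_union_of_diamonds d (pure_part d X).
Proof.
move=> d1 satX H; have [cX clX _] := satX.
have zV z : z \in big_faces d X -> z \subset vsupport d X z.
  by move=> _; exact/sub_vsupport/component_refl.
have cz z : z \in big_faces d X -> is_clique e z.
  by rewrite inE => /andP[/(mem_clique clX)].
have cardz z : z \in big_faces d X -> #|z| = d.+1.
  move=> zX; have [cardV cV] := H z zX.
  apply/eqP; rewrite eqn_leq (cocktail_clique_card e_sym cardV) ?zV ?cz //=.
  by move: zX; rewrite inE => /andP[].
have ext z s : z \in big_faces d X -> s \in induced_complex e (vsupport d X z) ->
    exists2 t, t \in component d X z & s \subset t.
  move=> zX; rewrite inE -andbA => /and3P[s0 sV cs]; have [cardV cV] := H z zX.
  have [t [st tV ct ht]] :=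
    cocktail_clique_ext e_sym cardV cV (zV z zX) (cz z zX) (cardz z zX) sV cs.
  by exists t => //; exact: cocktail_component.
apply/andP; split.
  apply/forall_inP => s sX; rewrite /face_dim; have [ds|ds] := ltnP d #|s|; last by nat_lia.
  by rewrite cardz // inE sX.
apply/existsP; exists [set induced_complex e (vsupport d X z) | z in big_faces d X].
apply/and3P; split.
- apply/forall_inP => _ /imsetP[z zX ->]; have [cardV cV] := H z zX.
  by apply: (cocktail_diamond e_sym cardV cV (zV z zX)); rewrite ?cz ?cardz.
- apply/forall_inP => _ /imsetP[z1 zX1 ->]; apply/forall_inP => _ /imsetP[z2 zX2 ->].
  apply/implyP => ne12; apply/forall_inP => s; rewrite in_setI => /andP[s1 s2].
  rewrite /face_dim -negb_or; apply: contra ne12 => cs.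
  have ds : d <= #|s| by case/orP: cs => /eqP cs; nat_lia.
  (* A common face with at least [d] vertices extends to a facet of each copy; these facets are
     adjacent, so the two components coincide. *)
  have [t1 tz1 st1] := ext _ _ zX1 s1; have [t2 tz2 st2] := ext _ _ zX2 s2.
  have : t2 \in component d X z1.
    have := component_big zX2 tz2; rewrite inE => /andP[tX2 dt2].
    apply: component_step (tz1) _ _ _ => //.
    by apply: leq_trans ds _; apply: subset_leq_card; rewrite subsetI st1.
  by move=> /vsupport_eq; rewrite (vsupport_eq tz2) => ->.
- apply/eqP/setP => s; apply/idP/bigcupP => [|[_ /imsetP[z zX ->]] sz].
    rewrite inE => /andP[sX /exists_inP[t tX /andP[/eqP dt st]]].
    have s0 : s != set0 by have := subsetP clX s sX; rewrite inE => /andP[].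
    have tb : t \in big_faces d X.
      by rewrite inE tX; move: dt; rewrite /face_dim; nat_lia.
    exists (induced_complex e (vsupport d X t)); first exact: imset_f.
    by rewrite inE s0 (subset_trans st (zV t tb)) (clique_sub st (cz t tb)).
  have [t tz st] := ext z s zX sz; have tb := component_big zX tz.
  have tX : t \in X by move: tb; rewrite inE => /andP[].
  have s0 : s != set0 by move: sz; rewrite inE -andbA => /and3P[].
  rewrite inE (complex_sub cX tX st s0); apply/exists_inP; exists t => //.
  by rewrite /face_dim cardz // eqxx.
Qed.

(** The degree bound is assumed for all families of cliques [X], since the components change as the
    collapse proceeds. *)
Lemma sparse_collapsible : 1 < d ->
  (forall X z, X \subset clique_complex e -> z \in big_faces d X ->
     \sum_(v in vsupport d X z) #|nbhd e (vsupport d X z) v| <= d.*2 * #|vsupport d X z|) ->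
  almost_collapsible d (clique_complex e).
Proof.
move=> d1 sparse; apply/existsP.
(* Saturated complexes are the invariant for an induction on the number of faces. *)
suff H X : saturated e d X -> exists Y, [/\ reduces d X Y, dim_at_most d Y
      & face_disjoint_union_of_diamonds d (pure_part d Y)].
  have [Y [red dY uY]] := H _ (saturated_clique_complex e d).
  by exists Y; apply/and3P; split => //; exact: reduces_collapses red.
have [n] := ubnP #|X|; elim: n X => // n IH X ltXn satX; have [_ clX _] := satX.
have [/forall_inP ckX|] := boolP [forall z in big_faces d X,
    (#|vsupport d X z| == d.+1.*2) &&
    [forall v in vsupport d X z, #|nbhd e (vsupport d X z) v|.+2 == #|vsupport d X z|]].
  exists X.
  have /andP[-> ->] : dim_at_most d X && face_disjoint_union_of_diamonds d (pure_part d X).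
    apply: cocktail_components_diamonds => // z /ckX/andP[/eqP cardV /forall_inP ck].
    by split=> // v /ck/eqP.
  by split=> //; exact: reduces_refl.
rewrite negb_forall_in => /exists_inP[z zX nck].
set V := vsupport d X z in nck.
have [k dk] : exists k, d = k.+1 by exists d.-1; nat_lia.
suff [v vV gv] : exists2 v, v \in V & good e k (nbhd e V v).
  have [X' [red satX' /proper_card X'X]] := sub_component_reduces e_sym dk satX zX vV gv.
  have [|Y [red' dY uY]] := IH X' _ satX'; first by nat_lia.
  by exists Y; split=> //; exact: reduces_trans red red'.
have [/forall_inP allge|] := boolP [forall v in V, d.*2 <= #|nbhd e V v|]; last first.
  rewrite negb_forall_in => /exists_inP[v vV]; rewrite -ltnNge => lt.
  by exists v => //; apply: (good_odd e_sym); nat_lia.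
(* All degrees are at least [d.*2] and their average is at most [d.*2], so equality holds
   throughout. *)
have alleq v : v \in V -> #|nbhd e V v| = d.*2.
  move=> vV; apply/eqP; rewrite eqn_leq allge // andbT.
  have := sparse X z clX zX; rewrite -/V (bigD1 v) //= (cardsD1 v V) vV /=.
  have : \sum_(i in V | i != v) d.*2 <= \sum_(i in V | i != v) #|nbhd e V i|.
    by apply: leq_sum => i /andP[iV _]; exact: allge.
  rewrite sum_nat_const (_ : #|_| = #|V :\ v|); last first.
    by apply: eq_card => i; rewrite !inE andbC.
  rewrite mulnDr muln1 [_ * d.*2]mulnC; nat_lia.
have [/forall_inP ck|] := boolP [forall v in V, [forall u in nbhd e V v,
     #|nbhd e (nbhd e V v) u|.+2 == #|nbhd e V v|]]; last first.
  rewrite negb_forall_in => /exists_inP[v vV /negP nckv]; exists v => //.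
  have [|//|[_ ck]] := @good_even T e e_sym k (nbhd e V v); first by rewrite alleq // dk.
  by case: nckv; apply/forall_inP => u /ck ->.
have [|cardV cV] := @cocktail_links X z d1 clX zX.
  move=> v vV; split; first exact: alleq.
  by move=> u uN; have /forall_inP/(_ u uN)/eqP := ck v vV.
case/negP: nck; rewrite cardV eqxx; apply/forall_inP => v vV.
by rewrite -cardV; apply/eqP/cV.
Qed.

End Deterministic.

(** * Dense strongly connected sets *)

Section Codes.
Variable T : finType.
Implicit Types (l : seq T) (N U r : {set T}) (Ex : {set T * T}).

(** [b] is a bit mask of length [D] on the positions of [l]; its range does not depend on [l], so a
    fixed number of bits per vertex suffices. *)
Definition sel D (b : {set 'I_D}) l : {set T} :=
  [set u in l | [exists i in b, val i == index u l]].

Lemma sel0 D l : sel (set0 : {set 'I_D}) l = set0.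
Proof.
apply/setP => u; rewrite !inE; apply/andP => -[_ /exists_inP[i]].
by rewrite inE.
Qed.

Lemma sel_surj D l r : size l <= D -> {subset r <= l} ->
  exists b : {set 'I_D}, sel b l = r.
Proof.
move=> lD rl; exists [set i : 'I_D | [exists u in r, val i == index u l]].
apply/setP => u; rewrite inE; apply/andP/idP => [[ul /exists_inP[i]]|ur].
  rewrite inE => /exists_inP[v vr /eqP iv] /eqP iu.
  have : index v l = index u l by rewrite -iv.
  by move=> E; rewrite -(nth_index u ul) -E nth_index // rl.
have ul := rl u ur; split=> //.
have lt : index u l < D by apply: leq_trans lD; rewrite index_mem.
apply/exists_inP; exists (Ordinal lt) => //; rewrite inE.
by apply/exists_inP; exists u.
Qed.

(* [f v] consists of a parent of [v] and of a code selecting, among the parent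
   and its back neighbours, those that are back neighbours of [v]; the
   remaining back edges are listed in [Ex].  The number of iterations only has
   to exceed the depth of the parent forest. *)
Fixpoint back_nbrs D (f : T -> T * {set 'I_D}) Ex n v : {set T} :=
  if n is n'.+1 then
    sel (f v).2 ((f v).1 :: enum (back_nbrs f Ex n' (f v).1)) :|:
    [set y | (v, y) \in Ex]
  else set0.

Definition code_pairs D (f : T -> T * {set 'I_D}) Ex U : {set T * T} :=
  [set p | (p.1 \in U) && (p.2 \in back_nbrs f Ex #|T| p.1)].

Definition code_edges D (f : T -> T * {set 'I_D}) Ex U : {set {set T}} :=
  [set [set p.1; p.2] | p in code_pairs f Ex U].

(** The recursion determines [N], because parents have smaller rank except where the mask is empty
    and the parent selects nothing. *)
Lemma back_nbrs_unique D (f : T -> T * {set 'I_D}) Ex (N : T -> {set T})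
    (U : {set T}) (rk : T -> nat) :
  {in U, forall v, N v = sel (f v).2 ((f v).1 :: enum (N (f v).1)) :|:
                         [set y | (v, y) \in Ex]} ->
  {in U, forall v, (f v).2 = set0 \/ (f v).1 \in U /\ rk (f v).1 < rk v} ->
  forall n v, v \in U -> rk v < n -> back_nbrs f Ex n v = N v.
Proof.
move=> NE fU; elim=> // n IH v vU vn /=; rewrite NE //.
have [->|[wU wv]] := fU v vU; first by rewrite !sel0.
by rewrite IH //; nat_lia.
Qed.

End Codes.

Lemma subset_card_between (T : finType) (A B : {set T}) k :
  A \subset B -> #|A| <= k <= #|B| ->
  exists C : {set T}, [/\ A \subset C, C \subset B & #|C| = k].
Proof.
move=> AB; elim: k => [|k IH] /andP[Ak kB].
  by exists A; split=> //; apply/eqP; rewrite -leqn0.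
move: Ak; rewrite leq_eqVlt => /orP[/eqP|] Ak; first by exists A.
have [|C [AC CB cC]] := IH; first by rewrite -ltnS Ak ltnW.
have /subsetPn[x xB xC] : ~~ (B \subset C).
  by apply: contraTN kB => /subset_leq_card; rewrite cC -ltnNge.
exists (x |: C); split; first by rewrite (subset_trans AC) ?subsetUr.
  by rewrite subUset sub1set xB.
by rewrite cardsU1 xC cC.
Qed.

(** * Growing a component vertex by vertex and encoding it *)

Section Growth.
Variables (T : finType) (e : rel T) (d : nat).
Hypothesis e_sym : symmetric e.
Implicit Types (s : seq T) (r z : {set T}) (X : {set {set T}}).

Definition grown s : Prop := uniq s /\
  forall s1 x s2, s = s1 ++ x :: s2 -> d <= size s1 ->
    exists r, [/\ {subset r <= s1}, is_clique e r, #|r| = d & {in r, forall y, e x y}].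

Definition back_edges s : {set T * T} :=
  [set p | [&& p.1 \in s, p.2 \in s, index p.2 s < index p.1 s & e p.1 p.2]].

Lemma grown_rcons_inv s x : grown (rcons s x) -> grown s.
Proof.
case; rewrite rcons_uniq => /andP[_ us] H; split=> // s1 y s2 E ds1.
by apply: (H s1 y (rcons s2 x)) => //; rewrite E rcons_cat.
Qed.

Lemma grown_rcons s x r : grown s -> x \notin s -> {subset r <= s} ->
  is_clique e r -> #|r| = d -> {in r, forall y, e x y} -> grown (rcons s x).
Proof.
move=> [us H] xs rs cr dr xr; split; first by rewrite rcons_uniq xs.
move=> s1 y s2; case/lastP: s2 => [|s2 x'].
  by rewrite cats1 => /rcons_inj[<- <-] _; exists r.
by rewrite -rcons_cons -rcons_cat => /rcons_inj[E _]; exact: H E.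
Qed.

Lemma subset_of_card r k : k <= #|r| -> exists2 r' : {set T}, r' \subset r & #|r'| = k.
Proof.
move=> kr; have [|C [_ Cr cC]] := @subset_card_between T set0 r k (sub0set r).
  by rewrite cards0.
by exists C.
Qed.

Lemma grown_clique z : is_clique e z -> grown (enum z).
Proof.
move=> cz; split; first exact: enum_uniq.
move=> s1 x s2 E ds1.
have us : uniq (s1 ++ x :: s2) by rewrite -E enum_uniq.
have s1z y : y \in s1 -> y \in z by move=> ys; rewrite -mem_enum E mem_cat ys.
have [|r rs cr] := @subset_of_card [set y in s1] d.
  by rewrite cardsE (card_uniqP _) //; move: us; rewrite cat_uniq => /and3P[].
have {}rs y : y \in r -> y \in s1 by move/(subsetP rs); rewrite inE.
exists r; split=> // [|y yr].
  by apply: clique_sub cz; apply/subsetP => y /rs/s1z.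
move/cliqueP: cz; apply; last 1 first.
- apply: contraTneq us => ->; rewrite cat_uniq /= rs //.
  by rewrite !(andbF, orbT).
- by rewrite -mem_enum E mem_cat mem_head orbT.
- exact/s1z/rs.
Qed.

Lemma grown_vsupport X z : X \subset clique_complex e -> z \in big_faces d X ->
  exists2 s, grown s & s =i vsupport d X z.
Proof.
move=> clX zX; set V := vsupport d X z.
have cz t : t \in component d X z -> is_clique e t.
  by move/(component_big zX); rewrite inE => /andP[/(mem_clique clX)].
suff H s : grown s -> {subset z <= s} -> {subset s <= V} ->
    exists2 s, grown s & s =i V.
  apply: (H (enum z)); first exact/grown_clique/cz/component_refl.
    by move=> x; rewrite mem_enum.
  by move=> x; rewrite mem_enum; exact/subsetP/sub_vsupport/component_refl.
have [n] := ubnP (#|V| - size s); elim: n s => // n IH s ltn gs zs sV.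
have [|] := boolP [exists t in component d X z, ~~ (t \subset s)]; last first.
  rewrite negb_exists_in => /forall_inP ts; exists s => // x.
  apply/idP/idP => [/sV//|/bigcupP[t tz xt]].
  by have := ts t tz; rewrite negbK => /subsetP; exact.
move=> /exists_inP[t0 t0z t0s].
(* Along the component some covered face is adjacent to an uncovered one; [d] common vertices form
   the clique to which a new vertex is attached. *)
have [t [t' [tz t'z dtt' ts t's]]] : exists t t', [/\ t \in component d X z,
    t' \in component d X z, d <= #|t :&: t'|, t \subset s & ~~ (t' \subset s)].
  have [/existsP[t /existsP[t' /and5P[]]]|nex] := boolP [exists t, exists t',
    [&& t \in component d X z, t' \in component d X z, d <= #|t :&: t'|,
         t \subset s & ~~ (t' \subset s)]].
    by exists t, t'.
  case/negP: t0s; move: t0 t0z; apply: component_ind; first exact/subsetP.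
  move=> t t' tz t'z dtt' ts; apply: contraNT nex => t's.
  by apply/existsP; exists t; apply/existsP; exists t'; apply/and5P.
have [x xt' xs] := subsetPn t's.
have [r rtt' dr] := subset_of_card dtt'.
have [rt rt'] : r \subset t /\ r \subset t' by apply/andP; rewrite -subsetI.
have rs : {subset r <= s} by move=> y /(subsetP rt); exact/subsetP.
have sub : {subset rcons s x <= V}.
  move=> y; rewrite mem_rcons inE => /orP[/eqP->|/sV//].
  exact: (subsetP (sub_vsupport t'z)).
apply: (IH (rcons s x)) => //.
- have us : uniq (rcons s x) by rewrite rcons_uniq xs; case: gs.
  have : #|[set y in rcons s x]| <= #|V|.
    by apply: subset_leq_card; apply/subsetP => y; rewrite inE => /sub.
  rewrite cardsE (card_uniqP us) size_rcons; nat_lia.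
- apply: (grown_rcons gs xs rs) dr _; first exact: clique_sub rt (cz t tz).
  move=> y yr; have /cliqueP ct' := cz t' t'z; apply: ct' => //.
    exact: (subsetP rt').
  by apply: contraNneq xs => ->; exact: rs.
- by move=> y /zs; rewrite mem_rcons inE orbC => ->.
Qed.

Lemma sum_nbhd_back_edges s (V : {set T}) : s =i V ->
  \sum_(v in V) #|nbhd e V v| <= #|back_edges s|.*2.
Proof.
move=> sV; pose B := back_edges s; pose sw (p : T * T) := (p.2, p.1).
apply: leq_trans (_ : #|B :|: sw @: B| <= _); last first.
  rewrite -addnn; apply: leq_trans (leq_card_setU _ _) _.
  by rewrite leq_add2l leq_imset_card.
rewrite (eq_bigr (fun v => \sum_(u in nbhd e V v) 1)); last first.
  by move=> v _; rewrite sum1_card.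
rewrite pair_big_dep /= sum1_card; apply: subset_leq_card; apply/subsetP => -[v u].
rewrite unfold_in /= !inE => /and4P[vV uV uv evu] /=.
have vs : v \in s by rewrite sV.
have us : u \in s by rewrite sV.
rewrite vs us evu andbT /=; case: ltngtP => // [lt|E]; last first.
  by have := index_inj v vs us (esym E); move=> vu; rewrite vu eqxx in uv.
by apply/imsetP; exists (u, v); rewrite // inE /= vs us lt e_sym.
Qed.

(** Vertices are peeled off the end until the prefix [s1] no longer exceeds the bound; the empty
    prefix does not exceed it. *)
Lemma grown_first_dense s : grown s -> d * size s < #|back_edges s| ->
  exists s1 x, [/\ grown (rcons s1 x), #|back_edges s1| <= d * size s1
                 & d * (size s1).+1 < #|back_edges (rcons s1 x)|].
Proof.
elim/last_ind: s => [|s x IH] gs lt.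
  have E : back_edges [::] = set0 by apply/setP => p; rewrite !inE.
  by rewrite E cards0 in lt.
have [le|gt] := leqP #|back_edges s| (d * size s); last first.
  by apply: IH => //; exact: grown_rcons_inv gs.
by exists s, x; split=> //; rewrite size_rcons in lt.
Qed.

Lemma back_edges_rcons s x : uniq (rcons s x) ->
  back_edges s = [set p in back_edges (rcons s x) | p.1 != x].
Proof.
rewrite rcons_uniq => /andP[xs us]; apply/setP => -[v u]; rewrite !inE /=.
rewrite !mem_rcons !inE -!cats1 !index_cat.
have [->|vx] /= := eqVneq v x; first by rewrite (negPf xs) !andbF.
rewrite andbT; have [vs|vs] //= := boolP (v \in s).
have [us'|us'] := boolP (u \in s); first by rewrite orbT.
have [->|] //= := eqVneq u x; rewrite addn0; apply/esym/negbTE.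
by rewrite negb_and -leqNgt ltnW // index_mem.
Qed.

(** The encoded graph consists of the edges [Tr] to the attached cliques, [d] for each vertex after
    the first [d], and of [d * d + 1] extra edges [Ex]; together [d * m + 1]. *)
Lemma grown_code x0 s1 x : 0 < d -> grown (rcons s1 x) ->
  #|back_edges s1| <= d * size s1 ->
  d * (size s1).+1 < #|back_edges (rcons s1 x)| ->
  let U := [set y in rcons s1 x] in
  exists (f : {ffun T -> T * {set 'I_(d * d + d).+2}}) (Ex : {set T * T}),
  [/\ f \in pffun_on (x0, set0) U (setX U [set: {set 'I_(d * d + d).+2}]),
      Ex \subset setX U U, #|Ex| = (d * d).+1,
      #|code_edges f Ex U| = (d * #|U|).+1
    & forall E, E \in code_edges f Ex U -> exists a b, E = [set a; b] /\ e a b].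
Proof.
move=> d0 [us gs] le1 gt U; set s := rcons s1 x in us gs gt U *.
(* [D] bounds the length of the list decoded at a vertex: its parent, at most [d] clique neighbours
   and at most [d * d + 1] extra ones. *)
set D := (d * d + d).+2; set m := size s.
have ms : m = (size s1).+1 by rewrite /m size_rcons.
have cU : #|U| = m by rewrite cardsE (card_uniqP us).
have memU y : (y \in U) = (y \in s) by rewrite inE.
pose B := back_edges s; pose B1 := back_edges s1.
have B1E : B1 = [set p in B | p.1 != x] by exact: back_edges_rcons.
have BU : B \subset setX U U.
  by apply/subsetP => p; rewrite !inE => /and4P[-> ->].
have dm : d < m.
  have := subset_leq_card BU; rewrite cardsX cU; rewrite -ms in gt.
  by move=> H; have := leq_trans gt H; rewrite mulnC ltn_mul2l => /andP[].
pose deep y := (y \in s) && (d <= index y s).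
pose Q y (ry : {set T}) := if deep y then [/\ is_clique e ry, #|ry| = d &
    {in ry, forall u, [/\ u \in s, index u s < index y s & e y u]}] else ry = set0.
have [r rP] : exists r : T -> {set T}, forall y, Q y (r y).
  apply: fin_all_exists => y; rewrite /Q.
  case: (boolP (deep y)) => [/andP[ys dy]|_]; last by exists set0.
  have [||r [rs cr dr yr]] := gs (take (index y s) s) y (drop (index y s).+1 s).
  - by rewrite -drop_index // cat_take_drop.
  - by rewrite size_take index_mem ys.
  exists r; split=> // u ur; have := rs u ur => ut; split; last exact: yr.
    exact: mem_take ut.
  by rewrite -in_take ?(mem_take ut).
have rdeep y u : u \in r y -> deep y.
  by have := rP y; rewrite /Q; case: ifP => // _ ->; rewrite inE.
have rS y u : u \in r y -> [/\ y \in s, u \in s, index u s < index y s & e y u].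
  move=> uy; have dy := rdeep y u uy.
  have := rP y; rewrite /Q dy => -[_ _ /(_ u uy)[us' lt eyu]].
  by split=> //; case/andP: dy.
pose Tr := [set p : T * T | p.2 \in r p.1].
have TrB : Tr \subset B.
  by apply/subsetP => p; rewrite !inE => /rS[-> -> -> ->].
have cTr (P : pred T) : #|[set p in Tr | P p.1]| = d * #|[set y | deep y && P y]|.
  transitivity (\sum_(y | deep y && P y) \sum_(u in r y) 1).
    rewrite pair_big_dep /= sum1_card; apply: eq_card => p.
    rewrite [RHS]unfold_in /= !inE.
    by case: (boolP (p.2 \in r p.1)) => [/rdeep -> |]; rewrite ?andbT ?andbF.
  rewrite (eq_bigr (fun=> d)); last first.
    by move=> y /andP[dy _]; rewrite sum1_card; have := rP y; rewrite /Q dy => -[].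
  by rewrite sum_nat_const mulnC cardsE.
have us' : uniq (take d s ++ drop d s) by rewrite cat_take_drop.
have deepE : [set y | deep y] = [set y in drop d s].
  apply/setP => y; rewrite !inE /deep.
  have [ys|ys] /= := boolP (y \in s); last by apply/esym/negP => /mem_drop; exact/negP.
  have := ys; rewrite -{1}(cat_take_drop d s) mem_cat leqNgt -(in_take _ ys).
  have [yt _|yt /= ->] // := boolP (y \in take d s).
  apply/esym/negP => yd; move: us'; rewrite cat_uniq => /and3P[_ /hasP[]].
  by exists y.
have cdeep : #|[set y | deep y]| = m - d.
  rewrite deepE cardsE (card_uniqP _) ?size_drop //.
  by move: us'; rewrite cat_uniq => /and3P[].
have idx : index x s = size s1.
  move: us; rewrite rcons_uniq => /andP[/negPf xs _].
  by rewrite /s -cats1 index_cat xs /= eqxx addn0.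
have xdeep : deep x.
  by rewrite /deep idx -ltnS -ms dm andbT /s mem_rcons mem_head.
have cTr1 : #|Tr| = d * (m - d).
  rewrite -cdeep -[in RHS](@eq_card _ [set y | deep y && predT y]); last first.
    by move=> y; rewrite !inE andbT.
  by rewrite -cTr; apply: eq_card => p; rewrite !inE andbT.
have cTr2 : #|B1 :&: Tr| = d * (m - d).-1.
  have -> : B1 :&: Tr = [set p in Tr | p.1 != x].
    apply/setP => p; have := subsetP TrB p; rewrite B1E !inE.
    by case: (p.2 \in r p.1) => [->|_]; rewrite ?andbT ?andbF.
  rewrite (cTr (fun y => y != x)) -cdeep (cardsD1 x [set y | deep y]) inE xdeep /=.
  by congr (_ * _); apply: eq_card => y; rewrite !inE andbC.
(* Minimality of the dense prefix leaves at most [d * d] back edges outside [Tr] before [x], and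
   density gives at least [d * d + 1] once [x] is added. Containing all the former, [Ex] makes every
   back edge of a vertex other than [x] decodable. *)
have [Ex [AEx ExB cEx]] : exists Ex : {set T * T},
    [/\ B1 :\: Tr \subset Ex, Ex \subset B :\: Tr & #|Ex| = (d * d).+1].
  apply: subset_card_between.
    by apply: setSD; rewrite B1E; apply/subsetP => p; rewrite inE => /andP[].
  rewrite !cardsD cTr2 (setIidPr TrB) cTr1 -ms in le1 gt *.
  rewrite -/B1 in le1; rewrite -/B in gt.
  have : exists k, m = d + k.+1 by exists (m - d).-1; nat_lia.
  case=> k mk; have mk' : size s1 = d + k by nat_lia.
  rewrite mk' mulnDr in le1; rewrite mk mulnDr in gt; rewrite mk addKn /=.
  by move: #|B1| #|B| le1 gt => b1 b2; clear; move: (d * d) (d * k) (d * k.+1); lia.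
have TrEx : [disjoint Tr & Ex].
  rewrite -setI_eq0; apply/eqP/setP => p; rewrite !inE.
  apply/negP => /andP[pT /(subsetP ExB)].
  by rewrite !inE pT.
have P_B : Tr :|: Ex \subset B.
  by rewrite subUset TrB (subset_trans ExB) // subsetDl.
pose Nb v := [set y | (v, y) \in Tr :|: Ex].
have cNb v : #|Nb v| < D.
  have cr : #|r v| <= d.
    by have := rP v; rewrite /Q; case: (deep v) => [[_ ->]//|->]; rewrite cards0.
  have cE : #|[set y | (v, y) \in Ex]| <= (d * d).+1.
    rewrite -cEx -(@card_imset _ _ (pair v)) => [|y y' []//].
    by apply: subset_leq_card; apply/subsetP => _ /imsetP[y + ->]; rewrite inE.
  apply: leq_ltn_trans (_ : #|r v :|: [set y | (v, y) \in Ex]| < _).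
    by apply: subset_leq_card; apply/subsetP => y; rewrite !inE.
  by apply: leq_ltn_trans (leq_card_setU _ _) _; rewrite /D; nat_lia.
pose F v (wb : T * {set 'I_D}) :=
  if v \in U then [/\ wb.1 \in U, r v = sel wb.2 (wb.1 :: enum (Nb wb.1))
    & wb.2 = set0 \/ wb.1 \in U /\ index wb.1 s < index v s]
  else wb = (x0, set0).
have [f0 f0P] : exists f0 : T -> T * {set 'I_D}, forall v, F v (f0 v).
  apply: fin_all_exists => v; rewrite /F.
  case: (boolP (v \in U)) => vU; last by exists (x0, set0).
  (* A vertex with no attached clique is its own parent with an empty mask; otherwise the parent is
     the last vertex [w] of the clique. *)
  have [r0|[u0 u0r]] := set_0Vmem (r v).
    by exists (v, set0); rewrite /= r0 sel0; split=> //; left.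
  case: (arg_maxnP (index^~ s) u0r) => w wr wmax.
  have [vs ws wv ev] := rS v w wr; have wU : w \in U by rewrite memU.
  have [||b bP] := @sel_surj T D (w :: enum (Nb w)) (r v).
  - by rewrite /= -cardE.
  - move=> u ur; rewrite inE mem_enum inE.
    have [//|uw] /= := eqVneq u w.
    have [_ us'' uv eu] := rS v u ur.
    have luw : index u s < index w s.
      rewrite ltn_neqAle [_ <= _](wmax u ur) andbT; apply: contra uw => /eqP E.
      by apply/eqP; apply: (index_inj u us'' ws).
    have ewu : e w u.
      have := rP v; rewrite /Q (rdeep v w wr) => -[/cliqueP cr _ _].
      by apply: cr => //; rewrite eq_sym.
    (* The parent [w] precedes [v], hence differs from the last vertex [x], so its back edges all
       lie in [Tr :|: Ex]. *)
    have wuB1 : (w, u) \in B1.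
      rewrite B1E !inE /= ws us'' luw ewu /=; apply: contraTneq wv => ->.
      by rewrite -leqNgt idx -ltnS -ms index_mem.
    rewrite in_setU; have [//|nT] := boolP ((w, u) \in Tr).
    by rewrite (subsetP AEx) // in_setD nT.
  by exists (w, b); split=> //=; right.
pose f := [ffun v => f0 v].
have bE v : v \in U -> back_nbrs f Ex #|T| v = Nb v.
  move=> vU; apply: (@back_nbrs_unique _ _ _ _ Nb U (index^~ s)) => //; last 1 first.
  - apply: leq_trans (max_card U); rewrite cU index_mem.
    by rewrite -memU.
  - move=> y yU; have := f0P y; rewrite /F yU ffunE => -[_ rE _].
    apply/setP => u; rewrite !inE -[X in X || _ = _]/(u \in r y) rE.
    by rewrite !inE.
  - by move=> y yU; have := f0P y; rewrite /F yU ffunE => -[].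
have cpE : code_pairs f Ex U = Tr :|: Ex.
  apply/setP => -[v y]; rewrite [LHS]inE /=.
  have [vU|vU] /= := boolP (v \in U); first by rewrite bE // inE.
  apply/esym/negbTE; apply: contra vU => /(subsetP P_B)/(subsetP BU).
  by rewrite in_setX => /andP[].
exists f, Ex; split => //.
- apply/pffun_onP; split.
    apply/subsetP => v; rewrite inE ffunE; apply: contraR => vU.
    by have := f0P v; rewrite /F (negPf vU) => ->.
  move=> _ /imageP[v vU ->]; have := f0P v; rewrite /F vU ffunE => -[wU _ _].
  by rewrite inE wU in_setT.
- by apply: subset_trans BU; apply: subset_trans ExB (subsetDl _ _).
- rewrite /code_edges cpE card_in_imset.
    rewrite cardsU (disjoint_setI0 TrEx) cards0 subn0 cTr1 cEx cU.
    have : exists k, m = d + k by exists (m - d); nat_lia.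
    by case=> k ->; rewrite addKn mulnDr; nat_lia.
  (* Back edges point from the later to the earlier vertex, so an unordered edge determines its
     pair. *)
  move=> [a b] [a' b'] /(subsetP P_B) abB /(subsetP P_B) abB' /= /setP E.
  have [_ _ lt _] : [/\ a \in s, b \in s, index b s < index a s & e a b].
    by move: abB; rewrite inE => /and4P.
  have [_ _ lt' _] : [/\ a' \in s, b' \in s, index b' s < index a' s & e a' b'].
    by move: abB'; rewrite inE => /and4P.
  have := E a; rewrite !inE eqxx /= => /esym/orP[/eqP aE|/eqP aE].
    have := E b; rewrite !inE eqxx orbT => /esym/orP[/eqP bE'|/eqP -> //];
      last by rewrite aE.
    by move: lt; rewrite bE' aE ltnn.
  have := E b; rewrite !inE eqxx orbT => /esym/orP[/eqP bE'|/eqP bE'].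
    by move: lt lt'; rewrite aE bE' => /ltnW; rewrite leqNgt => /negPf->.
  by move: lt; rewrite bE' aE ltnn.
- move=> E /imsetP[[a b]]; rewrite cpE => /(subsetP P_B).
  rewrite inE => /and4P[_ _ _ eab] ->.
  by exists a, b.
Qed.

End Growth.

(** * Counting codes *)

Section CodeCount.
Variables (T : finType) (d : nat).

Definition code_maps (x0 : T) (U : {set T}) :
    {pred {ffun T -> T * {set 'I_(d * d + d).+2}}} :=
  pffun_on (x0, set0) U (setX U [set: {set 'I_(d * d + d).+2}]).

Definition code_extras (U : {set T}) : {set {set T * T}} :=
  [set Ex : {set T * T} | Ex \subset setX U U & #|Ex| == (d * d).+1].

Lemma card_code_maps x0 U : #|code_maps x0 U| = (#|U| * 2 ^ (d * d + d).+2) ^ #|U|.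
Proof. by rewrite card_pffun_on cardsX -powersetT card_powerset cardsT card_ord. Qed.

Lemma card_code_extras U : #|code_extras U| = 'C(#|U| * #|U|, (d * d).+1).
Proof. by rewrite cards_draws cardsX. Qed.

Lemma not_collapsible_code (e : rel T) x0 : 1 < d -> symmetric e ->
  ~~ almost_collapsible d (clique_complex e) ->
  exists (U : {set T}) (f : {ffun T -> T * {set 'I_(d * d + d).+2}}) (Ex : {set T * T}),
  [/\ f \in code_maps x0 U, Ex \in code_extras U,
      #|code_edges f Ex U| = (d * #|U|).+1
    & forall E, E \in code_edges f Ex U -> exists a b, E = [set a; b] /\ e a b].
Proof.
move=> d1 e_sym nc.
have [X /existsP[z /and3P[clX zX]]] : exists X : {set {set T}}, [exists z,
    [&& X \subset clique_complex e, z \in big_faces d X &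
     d.*2 * #|vsupport d X z| < \sum_(v in vsupport d X z) #|nbhd e (vsupport d X z) v|]].
  apply/existsP; apply: contraNT nc; rewrite negb_exists => /forallP noX.
  apply: sparse_collapsible => // X z clX zX; rewrite leqNgt; apply/negP => lt.
  by have /existsP[] := noX X; exists z; rewrite clX zX.
set V := vsupport d X z => ltV.
have [s gs sV] := grown_vsupport clX zX.
have us : uniq s by case: gs.
have cs : size s = #|V| by rewrite -(card_uniqP us); apply: eq_card => x; rewrite sV.
have lt : d * size s < #|back_edges e s|.
  have := leq_trans ltV (sum_nbhd_back_edges e_sym sV).
  by rewrite -doubleMl ltn_double cs.
have [s1 [x [gsx le1 gt]]] := grown_first_dense gs lt.
have [f [Ex [fU ExU cEx cE fE]]] := grown_code x0 (ltnW d1) gsx le1 gt.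
by exists [set y in rcons s1 x], f, Ex; split=> //; rewrite inE ExU cEx /=.
Qed.

End CodeCount.

(** * Binomial and factorial estimates *)

Lemma leq_bin_exp n m : 'C(n, m) <= 2 ^ n.
Proof.
rewrite -[n in 'C(n, _)]card_ord -card_draws -[n in 2 ^ n]card_ord -cardsT.
by rewrite -card_powerset powersetT; exact/subset_leq_card/subsetT.
Qed.

Lemma leq_exp_ffact m k : m ^ k <= (m + k) ^_ k.
Proof.
elim: k => // k IH; rewrite addnS ffactSS expnS leq_mul //.
by rewrite -addnS leq_addr.
Qed.

Lemma leq_ffact_exp n m : n ^_ m <= n ^ m.
Proof. by elim: m => // m IH; rewrite ffactnSr expnSr leq_mul // leq_subr. Qed.

Lemma leq_exp_fact m : m ^ m <= 4 ^ m * m`!.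
Proof.
apply: leq_trans (leq_exp_ffact m m) _; rewrite -bin_ffact leq_mul2r.
by rewrite -[4]/(2 ^ 2) -expnM mul2n -addnn leq_bin_exp orbT.
Qed.

Lemma leq_exp_const m k : m ^ k <= k`! * 2 ^ k * 2 ^ m.
Proof.
apply: leq_trans (leq_exp_ffact m k) _; rewrite -bin_ffact mulnC -mulnA leq_mul2l.
by rewrite -expnD addnC leq_bin_exp orbT.
Qed.

Lemma leq_bin_pow n m : 'C(n, m) <= n ^ m.
Proof.
apply: leq_trans (leq_ffact_exp n m); rewrite -bin_ffact.
by rewrite leq_pmulr // fact_gt0.
Qed.

(** The factor [m ^ m] from the parents costs only [4 ^ m] against the [m!] in ['C(n, m)], and the
    choice of [K] extra pairs, polynomial in [m], costs a constant times [2 ^ m]; hence the three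
    extra powers of two. *)
Lemma code_count n m D K :
  'C(n, m) * ((m * 2 ^ D) ^ m * 'C(m * m, K)) <=
  (K.*2)`! * 2 ^ K.*2 * (2 ^ D.+3 * n) ^ m.
Proof.
have H1 : 'C(n, m) * m ^ m <= 4 ^ m * n ^ m.
  apply: leq_trans (leq_mul (leqnn _) (leq_exp_fact m)) _.
  by rewrite mulnCA bin_ffact leq_mul2l leq_ffact_exp orbT.
have H2 : 'C(m * m, K) <= (K.*2)`! * 2 ^ K.*2 * 2 ^ m.
  apply: leq_trans (leq_bin_pow _ _) _.
  by rewrite mulnn -expnM mul2n leq_exp_const.
rewrite expnMn mulnA mulnA -mulnA.
apply: leq_trans (leq_mul H1 (leq_mul (leqnn _) H2)) _.
rewrite -(addn3 D) expnD (_ : 2 ^ 3 = 4 * 2) // !expnMn.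
by apply: eq_leq; ring.
Qed.

(** This is where the threshold on [c] enters: the left side is the exponential rate of
    [code_count], the right side the [d]-th power of the reciprocal threshold. *)
Lemma leq_code_const d : 1 < d -> 2 ^ (d * d + d).+2.+3 <= (2 ^ (2 * d + 1) * d) ^ d.
Proof.
move=> d1; rewrite expnMn -expnM.
have d2d : 2 ^ d <= d ^ d by rewrite leq_exp2r; lia.
apply: leq_trans (leq_mul (leqnn _) d2d); rewrite -expnD leq_exp2l //.
nia.
Qed.

From mathcomp Require Import all_classical all_reals all_analysis.

Import Order.TTheory GRing.Theory Num.Theory.
Import numFieldNormedType.Exports.
Local Open Scope ring_scope.

(** * Probability *)

Section Gnp.
Variables (R : realType) (n : nat) (p : R).
Hypotheses (p_ge0 : 0 <= p) (p_le1 : p <= 1).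
Implicit Types (A B : pred {set {set 'I_n}}) (E S : {set {set 'I_n}}).

Lemma gnp_weight_ge0 E : 0 <= gnp_weight p E.
Proof. by apply: prodr_ge0 => e _; case: ifP; rewrite ?subr_ge0. Qed.

Lemma gnp_prob_ge0 A : 0 <= gnp_prob p A.
Proof. by apply: sumr_ge0 => E _; exact: gnp_weight_ge0. Qed.

Lemma gnp_prob_predC A : gnp_prob p A = 1 - gnp_prob p (predC A).
Proof.
apply/eqP; rewrite eq_sym subr_eq -(gnp_prob_total n p) /gnp_prob.
by rewrite (bigID A) /=; apply/eqP; congr (_ + _); apply: eq_bigl => E; rewrite andbT.
Qed.

Lemma le_gnp_prob_union (I : finType) (C : {pred I}) A (B : I -> pred {set {set 'I_n}}) :
  (forall E, E \subset vpairs n -> A E -> exists2 i, i \in C & B i E) ->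
  gnp_prob p A <= \sum_(i in C) gnp_prob p (B i).
Proof.
move=> AB; rewrite /gnp_prob (exchange_big_dep (mem (powerset (vpairs n)))) /=; last first.
  by move=> i E _ /andP[].
rewrite big_mkcondr /=; apply: ler_sum => E EP.
case: ifP => [AE|_]; last by apply: sumr_ge0 => i _; exact: gnp_weight_ge0.
have [|i iC BE] := AB E _ AE; first by move: EP; rewrite powersetE.
rewrite (bigD1 i) /=; last by rewrite iC EP.
by rewrite lerDl; apply: sumr_ge0 => j _; exact: gnp_weight_ge0.
Qed.

Lemma le_gnp_prob_union_const (I : finType) (C : {pred I}) A
    (B : I -> pred {set {set 'I_n}}) x :
  (forall E, E \subset vpairs n -> A E -> exists2 i, i \in C & B i E) ->
  (forall i, i \in C -> gnp_prob p (B i) <= x) ->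
  gnp_prob p A <= #|C|%:R * x.
Proof.
move=> AB Bx; apply: le_trans (le_gnp_prob_union AB) _.
by rewrite mulr_natl -sumr_const; apply: ler_sum.
Qed.

(** Equality holds when [S] consists of vertex pairs, by expanding a product of sums [a e + b e];
    otherwise the event is empty. *)
Lemma gnp_prob_subset S : gnp_prob p (fun E => S \subset E) <= p ^+ #|S|.
Proof.
have [SP|SP] := boolP (S \subset vpairs n); last first.
  rewrite /gnp_prob big_pred0 ?exprn_ge0 // => E; apply/negbTE; apply: contra SP.
  by rewrite powersetE => /andP[EP SE]; exact: fintype.subset_trans SE EP.
pose P := vpairs n.
pose a (e : {set 'I_n}) : R := if e \in P then p else 0.
(* The zero on [S] kills the terms of edge sets not containing [S], and the zero of [a] outside [P]
   those with a non-edge. *)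
pose b (e : {set 'I_n}) : R := if e \in P then (if e \in S then 0 else 1 - p) else 1.
rewrite /gnp_prob /gnp_weight; rewrite le_eqVlt; apply/orP; left; apply/eqP.
transitivity (\prod_e (a e + b e)); last first.
  rewrite (bigID (mem S)) /= [X in _ * X]big1 ?mulr1.
    rewrite (eq_bigr (fun=> p)) ?prodr_const // => e eS.
    by rewrite /a /b eS (fintype.subsetP SP) // addr0.
  move=> e eS; rewrite /a /b (negbTE eS); case: ifP => _; rewrite ?add0r //.
  by rewrite addrC subrK.
rewrite bigA_distr [RHS](bigID (fun E => (E \in powerset P) && (S \subset E))) /=.
rewrite [X in _ = _ + X]big1 ?addr0 => [|E].
  apply: eq_big => [E|E /andP[]]; rewrite ?andbT //= powersetE => /fintype.subsetP EP.
  move=> /fintype.subsetP SE; rewrite [RHS](bigID (fun e => e \in P)) /=.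
  rewrite [X in _ = _ * X]big1 ?mulr1.
    apply: eq_bigr => e eP; rewrite /a /b eP; case: ifP => // /negbT eE.
    by rewrite (negbTE (contra (SE e) eE)).
  by move=> e eP; rewrite /a /b (negbTE eP); case: ifP => // /EP; rewrite (negbTE eP).
rewrite powersetE negb_and => /orP[] /subsetPn[e eE eP].
  by rewrite (bigD1 e) //= eE /a (negbTE eP) mul0r.
by rewrite (bigD1 e) //= (negbTE eP) /b eE (fintype.subsetP SP) // mul0r.
Qed.

End Gnp.

Lemma le_geometric (R : realFieldType) (q : R) n : 0 <= q -> q < 1 ->
  \sum_(i < n) q ^+ i <= (1 - q)^-1.
Proof.
move=> q0 q1; have q1' : 0 < 1 - q by rewrite subr_gt0.
rewrite -[leRHS]mul1r ler_pdivlMr // mulrC -[1 - q]opprB mulNr -subrX1 opprB.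
by rewrite lerBlDr lerDl exprn_ge0.
Qed.

Lemma adj_sym n (E : {set {set 'I_n}}) : symmetric (adj E).
Proof. by move=> u v; rewrite /adj finset.setUC. Qed.

(* Union bound over the codes of the dense strongly connected sets of size
   [m]; here [code_count] absorbs the [m!] orderings of the set. *)
Lemma gnp_not_collapsible (R : realType) (n d : nat) (p : R) : (1 < d)%N ->
  0 <= p -> p <= 1 ->
  gnp_prob p (fun E : {set {set 'I_n.+1}} =>
    ~~ almost_collapsible d (clique_complex (adj E))) <=
  (((d * d).+1.*2)`! * 2 ^ (d * d).+1.*2)%:R * p *
    \sum_(m < n.+2) ((2 ^ (d * d + d).+2.+3 * n.+1)%:R * p ^+ d) ^+ m.
Proof.
move=> d1 p0 p1; set D := (d * d + d).+2; set K := (d * d).+1.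
pose hit (U : {set 'I_n.+1}) (f : {ffun 'I_n.+1 -> 'I_n.+1 * {set 'I_D}})
    (Ex : {set 'I_n.+1 * 'I_n.+1}) (E : {set {set 'I_n.+1}}) :=
  (#|code_edges f Ex U| == (d * #|U|).+1) && (code_edges f Ex U \subset E).
pose evUf U f E := [exists Ex in code_extras d U, hit U f Ex E].
pose evU U E := [exists f in code_maps ord0 U, evUf U f E].
pose evm (m : 'I_n.+2) E := [exists U in [set U : {set 'I_n.+1} | #|U| == m], evU U E].
apply: le_trans (@le_gnp_prob_union R n.+1 p p0 p1 _ predT _ evm _) _.
  move=> E _ /(not_collapsible_code ord0 d1 (adj_sym E)).
  move=> [U [f [Ex [fU ExU cE sE]]]].
  have mlt : (#|U| < n.+2)%N by rewrite ltnS -[leqRHS]card_ord max_card.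
  exists (Ordinal mlt) => //; apply/exists_inP; exists U; first by rewrite inE.
  apply/exists_inP; exists f => //; apply/exists_inP; exists Ex => //.
  rewrite /hit cE eqxx; apply/fintype.subsetP => S /sE[a [b [-> ab]]]; exact: ab.
rewrite mulr_sumr; apply: ler_sum => m _.
(* Nested union bounds over the vertex set, the parent map and the extra edges give the three
   counting factors in turn. *)
apply: le_trans
    (_ : ('C(n.+1, m) * ((m * 2 ^ D) ^ m * 'C(m * m, K)))%:R * p ^+ (d * m).+1 <= _).
  rewrite !natrM -!mulrA.
  have -> : 'C(n.+1, m) = #|[set U : {set 'I_n.+1} | #|U| == m]|.
    by rewrite card_draws card_ord.
  apply: (@le_gnp_prob_union_const R n.+1 p p0 p1 _ _ _ evU)
    => [E _ /exists_inP[U Um UE]|U Um]; first by exists U.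
  have cU : #|U| = m by move: Um; rewrite inE => /eqP.
  rewrite -cU -(@card_code_maps _ d ord0 U).
  apply: (@le_gnp_prob_union_const R n.+1 p p0 p1 _ _ _ (evUf U))
    => [E _ /exists_inP[f fU fE]|f fU]; first by exists f.
  rewrite -card_code_extras.
  apply: (@le_gnp_prob_union_const R n.+1 p p0 p1 _ _ _ (hit U f))
    => [E _ /exists_inP[Ex ExU ExE]|Ex ExU]; first by exists Ex.
  have [cE|cE] := eqVneq #|code_edges f Ex U| (d * #|U|).+1.
    rewrite -cE; apply: le_trans (gnp_prob_subset p0 (code_edges f Ex U)).
    rewrite le_eqVlt; apply/orP; left; apply/eqP.
    by apply: eq_bigl => E; rewrite /hit cE eqxx.
  by rewrite /gnp_prob big_pred0 ?exprn_ge0 // => E; rewrite /hit (negbTE cE) andbF.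
rewrite exprSr exprM.
apply: le_trans
    (_ : (K.*2`! * 2 ^ K.*2 * (2 ^ D.+3 * n.+1) ^ m)%:R * ((p ^+ d) ^+ m * p) <= _).
  by apply: ler_wpM2r; rewrite ?mulr_ge0 ?exprn_ge0 // ler_nat code_count.
rewrite [(_ * (2 ^ D.+3 * n.+1) ^ m)%:R]natrM natrX exprMn.
by rewrite le_eqVlt; apply/orP; left; apply/eqP; ring.
Qed.

(** * Asymptotics of the edge probability *)

Section EdgeProbability.
Variables (R : realType) (d : nat) (c : R).
Hypotheses (d_gt0 : (0 < d)%N) (c_gt0 : 0 < c).

Lemma natr_root_expr n : (n%:R `^ d%:R^-1) ^+ d = n%:R :> R.
Proof.
by rewrite -powR_mulrn ?powR_ge0 // -powRrM mulVf ?pnatr_eq0 -?lt0n // powRr1.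
Qed.

Lemma edge_prob_expr n : (c / n%:R `^ d%:R^-1) ^+ d = c ^+ d / n%:R.
Proof. by rewrite expr_div_n natr_root_expr. Qed.

Lemma edge_prob_ge0 n : 0 <= c / n%:R `^ d%:R^-1.
Proof. by rewrite divr_ge0 ?powR_ge0 // ltW. Qed.

Lemma edge_prob_le1 n : c <= 1 -> c / n.+1%:R `^ d%:R^-1 <= 1.
Proof.
move=> c1; rewrite -(@expr_le1 _ d) ?edge_prob_ge0 // edge_prob_expr.
by rewrite ler_pdivrMr ?ltr0n // mul1r (le_trans (exprn_ile1 _ _ c1)) ?ler1n // ltW.
Qed.

Lemma edge_prob_cvg0 :
  ((fun n : nat => c / n%:R `^ d%:R^-1) @ \oo --> (0 : R))%classic.
Proof.
apply/cvgr0Pnorm_lt => eps eps0; near=> n.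
rewrite ger0_norm ?edge_prob_ge0 //.
rewrite -(@ltr_pXn2r _ d) ?nnegrE ?edge_prob_ge0 ?ltW // edge_prob_expr.
have n0 : 0 < n%:R :> R.
  by rewrite ltr0n; near: n; exact: nbhs_infty_gt.
rewrite ltr_pdivrMr // mulrC -ltr_pdivrMr ?exprn_gt0 //.
by near: n; exact: nbhs_infty_gtr.
Unshelve. all: by end_near. Qed.

End EdgeProbability.

Theorem theorem2p1 (R : realType) (d : nat) (c : R)
  (d_ge2 : (2 <= d)%N) (c_gt0 : 0 < c)
  (c_lt : c < 1 / (2 ^+ (2 * d + 1) * d%:R)) :
  whp (fun n : nat => c / (n%:R `^ (d%:R^-1)))
      (fun n (E : {set {set 'I_n}}) =>
         almost_collapsible d (clique_complex (adj E))).
Proof.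
have d_gt0 : (0 < d)%N by exact: ltnW.
pose b : R := 2 ^+ (2 * d + 1) * d%:R.
have b1 : 1 <= b.
  by rewrite /b -natrX -natrM ler1n muln_gt0 expn_gt0 d_gt0.
have b0 : 0 < b by exact: lt_le_trans b1.
have bc1 : c * b < 1 by rewrite -ltr_pdivlMr.
have c1 : c <= 1 by apply: le_trans (ltW bc1); rewrite ler_peMr // ltW.
(* [q] dominates the ratio of the geometric series in the first moment bound, independently of
   [n]. *)
pose q := (c * b) ^+ d.
have q0 : 0 <= q by rewrite exprn_ge0 // mulr_ge0 ?ltW.
have q1 : q < 1 by rewrite exprn_ilt1 -?lt0n // mulr_ge0 ?ltW.
pose C : R := (((d * d).+1.*2)`! * 2 ^ (d * d).+1.*2)%:R.
pose p (n : nat) : R := c / n%:R `^ d%:R^-1.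
(* With the series bounded, the spare factor [p n.+1], due to the one edge beyond [d * m], drives
   the failure probability to zero. *)
have bound n : 1 - C * (1 - q)^-1 * p n.+1 <= gnp_prob (p n.+1)
    (fun E : {set {set 'I_n.+1}} => almost_collapsible d (clique_complex (adj E))) <= 1.
  have p0 : 0 <= p n.+1 by exact: edge_prob_ge0.
  have p1 : p n.+1 <= 1 by exact: edge_prob_le1.
  rewrite gnp_prob_predC; apply/andP; split; last by rewrite gerBl gnp_prob_ge0.
  rewrite lerB //; apply: le_trans (gnp_not_collapsible n d_ge2 p0 p1) _.
  rewrite -/C mulrAC; apply: ler_wpM2r => //; apply: ler_wpM2l => //.
  apply: le_trans (le_geometric n.+2 q0 q1); apply: ler_sum => m _.
  apply: lerXn2r; rewrite ?nnegrE //; first by rewrite mulr_ge0 ?exprn_ge0.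
  rewrite /p edge_prob_expr // natrM mulrACA mulfV ?pnatr_eq0 // mulr1.
  rewrite /q exprMn [leRHS]mulrC; apply: ler_wpM2r; first by rewrite exprn_ge0 // ltW.
  by rewrite /b -natrX -natrM -natrX ler_nat leq_code_const.
have pC0 : ((fun n => 1 - C * (1 - q)^-1 * p n) @ \oo --> (1 : R))%classic.
  have : ((fun n => 1 - C * (1 - q)^-1 * p n) @ \oo -->
          (1 - C * (1 - q)^-1 * 0 : R))%classic.
    apply: cvgB; first exact: cvg_cst.
    by apply: cvgM; [exact: cvg_cst | exact: edge_prob_cvg0].
  by rewrite mulr0 subr0.
rewrite /whp; apply: (squeeze_cvgr _ pC0); last exact: (@cvg_cst _ (1 : R)).
near=> n; have n0 : (0 < n)%N by near: n; exact: nbhs_infty_gt.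
by rewrite -(prednK n0); exact: bound.
Unshelve. all: by end_near. Qed.
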